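(* The secrecy problem for cryptographic protocols with single blind copying, with a bounded number of nonces but an unbounded number of sessions, is DEXPTIME-hard. This holds even when no message is allowed to be stored at any control point, i.e. even when every control point has arity $0$.
   Context: Terms (messages) are built over a finite signature $\Sigma$ of function symbols, with variables $x,y,\dots$. $\Sigma$ contains a binary encryption symbol $\{\_\}_{\_}$ and a binary pairing symbol $\langle\_,\_\rangle$. Nonces, agent names, keys, etc. are constants of $\Sigma$, so there are only finitely many nonces, and they are reused across arbitrarily many sessions. A state is $S(M_1,\dots,M_n)$, where $S$ is an $n$-ary symbol from a finite set of control points and the $M_i$ are messages. The control points carry a strict partial order $<$. An initialization state is a variable-free state. A protocol rule has the form $S_1(M_1,\dots,M_m):\mathsf{recv}(M)\rightarrow S_2(N_1,\dots,N_n):\mathsf{send}(N)$ with $S_1<S_2$. Here $M$ and $N$ are messages, or a dummy symbol $?$ meaning nothing is received or sent; $?$ is identified with a public constant known to the adversary. A protocol is a finite set of initialization states and protocol rules. It has single blind copying if every protocol rule contains at most one variable, which may occur any number of times in the rule. Semantics. Initialization states may be created and rules executed any number of times. This is modelled by Horn clauses with unary predicates $\mathsf{reach}$ and $\mathsf{known}$, where each control point is treated as a function symbol: - $\mathsf{reach}(S(M_1,\dots,M_n))$ for each initialization state; - for each rule, the two clauses $\mathsf{known}(N)\lor-\mathsf{reach}(S_1(M_1,\dots,M_m))\lor-\mathsf{known}(M)$ and $\mathsf{reach}(S_2(N_1,\dots,N_n))\lor-\mathsf{reach}(S_1(M_1,\dots,M_m))\lor-\mathsf{known}(M)$; - adversary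 clauses for encryption $\mathsf{known}(\{x_1\}_{x_2})\lor-\mathsf{known}(x_1)\lor-\mathsf{known}(x_2)$ and decryption $\mathsf{known}(x_1)\lor-\mathsf{known}(\{x_1\}_{x_2})\lor-\mathsf{known}(x_2)$; - the analogous clauses for pairing and for both projections of pairs; - $\mathsf{known}(f(x_1,\dots,x_n))\lor-\mathsf{known}(x_1)\lor\dots\lor-\mathsf{known}(x_n)$ for each function $f$ the adversary may apply; - $\mathsf{known}(c)$ for each datum $c$ initially known to the adversary. A ground message $M$ is known to the adversary iff $\mathsf{known}(M)$ is in the least Herbrand model of these clauses. The secrecy problem is: given such a protocol, the adversary's initial knowledge and functions, and a ground message $M$, decide whether $M$ remains secret, i.e. is not known to the adversary. *)

(* Defs.v *)
From mathcomp Require Import all_boot.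
From Stdlib Require List.

Set Implicit Arguments.
Unset Strict Implicit.
Unset Printing Implicit Defensive.

(** * Deterministic multi-tape Turing machines and DEXPTIME-hardness *)

(* [None] is the blank, [Some (inl b)] an input/output bit, and
   [Some (inr x)] an auxiliary symbol of the machine. *)
Definition sym (X : finType) : Type := option (bool + X).

Inductive move := Left | Stay | Right.

(* The machine has [tm_tapes.+1] two-way infinite tapes; it halts exactly when
   [tm_step] returns [None]. *)
Record tm := TM {
  tm_tapes : nat;
  tm_aux : finType;
  tm_state : finType;
  tm_start : tm_state;
  tm_accept : pred tm_state;
  tm_step : tm_state -> {ffun 'I_tm_tapes.+1 -> sym tm_aux} ->
            option (tm_state * ('I_tm_tapes.+1 -> sym tm_aux * move))
}.

(* [(l, r)]: [r] lists the cells from the scanned one rightwards, [l] those to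
   its left, nearest first; all cells not listed are blank. *)
Definition tape (X : finType) : Type := (seq (sym X) * seq (sym X))%type.

Definition scanned (X : finType) (t : tape X) : sym X := head None t.2.

Definition write_move (X : finType) (t : tape X) (a : sym X * move) : tape X :=
  let: (l, r) := t in
  let: (s, m) := a in
  match m with
  | Left => (behead l, head None l :: s :: behead r)
  | Stay => (l, s :: behead r)
  | Right => (s :: l, behead r)
  end.

Definition bits_tape (X : finType) (w : seq bool) : tape X :=
  ([::], [seq Some (inl b) | b <- w]).

Fixpoint leading_bits (X : finType) (s : seq (sym X)) : seq bool :=
  if s is Some (inl b) :: s' then b :: leading_bits s' else [::].

Section Run.

Variable T : tm.

Definition config : Type :=
  (tm_state T * ('I_(tm_tapes T).+1 -> tape (tm_aux T)))%type.

Definition init_config (w : seq bool) : config :=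
  (tm_start T, fun i => if i == ord0 then bits_tape _ w else ([::], [::])).

Definition next (c : config) := tm_step c.1 [ffun i => scanned (c.2 i)].

Definition halted (c : config) : bool := ~~ isSome (next c).

Definition step (c : config) : config :=
  if next c is Some (q, a) then (q, fun i => write_move (c.2 i) (a i)) else c.

(* Halted configurations are fixed by [step], so [halted (run t w)] says that
   the machine halts on [w] within [t] steps. *)
Definition run (t : nat) (w : seq bool) : config := iter t step (init_config w).

(* The output word starts at the head of tape 0 and extends to the right up to
   the first cell not containing a bit. *)
Definition output (c : config) : seq bool := leading_bits (c.2 ord0).2.

Definition decides_in_time (L : seq bool -> Prop) (f : nat -> nat) : Prop :=
  forall w, let c := run (f (size w)) w in
    halted c /\ (tm_accept c.1 <-> L w).

Definition computes_in_time (g : seq bool -> seq bool) (f : nat -> nat) : Prop :=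
  forall w, let c := run (f (size w)) w in halted c /\ output c = g w.

End Run.

Definition dexptime (L : seq bool -> Prop) : Prop :=
  exists (T : tm) (c k : nat), decides_in_time T L (fun n => 2 ^ (c * n ^ k + c)).

Definition polytime (g : seq bool -> seq bool) : Prop :=
  exists (T : tm) (c k : nat), computes_in_time T g (fun n => c * n ^ k + c).

Definition polytime_reducible (L K : seq bool -> Prop) : Prop :=
  exists2 g : seq bool -> seq bool, polytime g & forall w, L w <-> K (g w).

Definition dexptime_hard (K : seq bool -> Prop) : Prop :=
  forall L : seq bool -> Prop, dexptime L -> polytime_reducible L K.

(** * Terms and Horn clauses *)

(* [Dummy] is the symbol "?", identified with a public constant.  The other
   symbols of the signature are the [Fn i], and the control points, used as
   function symbols, are the [Ctrl i]. *)
Inductive symbol := Enc | Pair | Dummy | Fn of nat | Ctrl of nat.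

Inductive term := Var of nat | App of symbol & seq term.

Definition encrypt (m k : term) : term := App Enc [:: m; k].
Definition pairing (m n : term) : term := App Pair [:: m; n].
Definition dummy : term := App Dummy [::].

Fixpoint vars (t : term) : seq nat :=
  match t with
  | Var x => [:: x]
  | App _ ts => flatten [seq vars u | u <- ts]
  end.

Definition ground (t : term) : bool := nilp (vars t).

Fixpoint subst (s : nat -> term) (t : term) : term :=
  match t with
  | Var x => s x
  | App f ts => App f [seq subst s u | u <- ts]
  end.

(* [ok f n]: the symbol [f] is allowed and has arity [n]. *)
Fixpoint well_formed (ok : symbol -> nat -> bool) (t : term) : bool :=
  match t with
  | Var _ => true
  | App f ts => ok f (size ts) && all (well_formed ok) ts
  end.

Inductive atom := Reach of term | Known of term.

Definition subst_atom (s : nat -> term) (a : atom) : atom :=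
  match a with
  | Reach t => Reach (subst s t)
  | Known t => Known (subst s t)
  end.

Record clause := Clause { head_atom : atom; body : seq atom }.

(* [U] is the Herbrand universe. *)
Definition herbrand_model (U : pred term) (C : seq clause) (I : atom -> Prop) :
    Prop :=
  forall (c : clause) (s : nat -> term),
    List.In c C -> (forall x, U (s x)) ->
    (forall b, List.In b (body c) -> I (subst_atom s b)) ->
    I (subst_atom s (head_atom c)).

Definition least_herbrand_model (U : pred term) (C : seq clause) (a : atom) :
    Prop :=
  forall I : atom -> Prop, herbrand_model U C I -> I a.

(** * Protocols and the secrecy problem *)

Definition state : Type := (nat * seq term)%type.

Definition state_term (st : state) : term := App (Ctrl st.1) st.2.

Record rule := Rule {
  source : state;
  recv : term;
  target : state;
  send : term
}.

Definition rule_vars (r : rule) : seq nat :=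
  vars (state_term (source r)) ++ vars (recv r) ++
  vars (state_term (target r)) ++ vars (send r).

(* An instance of the secrecy problem: [fn_arity] and [ctrl_arity] list the
   arities of the symbols [Fn i] and of the control points [Ctrl i];
   [ctrl_order] is the graph of the order on control points; [adv_functions]
   and [adv_constants] are indices of symbols [Fn i]; and [secret] is the
   message whose secrecy is in question. *)
Record instance := Instance {
  fn_arity : seq nat;
  ctrl_arity : seq nat;
  ctrl_order : seq (nat * nat);
  inits : seq state;
  rules : seq rule;
  adv_functions : seq nat;
  adv_constants : seq nat;
  secret : term
}.

Section Instance.

Variable P : instance.

Definition has_arity (ar : seq nat) (i n : nat) : bool :=
  (i < size ar) && (n == nth 0 ar i).

Definition signature (f : symbol) (n : nat) : bool :=
  match f with
  | Enc | Pair => n == 2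
  | Dummy => n == 0
  | Fn i => has_arity (fn_arity P) i n
  | Ctrl _ => false
  end.

Definition signature_ctrl (f : symbol) (n : nat) : bool :=
  if f is Ctrl i then has_arity (ctrl_arity P) i n else signature f n.

Definition message (t : term) : bool := well_formed signature t.

Definition is_state (st : state) : bool :=
  has_arity (ctrl_arity P) st.1 (size st.2) && all message st.2.

Definition universe (t : term) : bool := well_formed signature_ctrl t && ground t.

Definition ctrl_lt (i j : nat) : bool := (i, j) \in ctrl_order P.

Definition is_strict_order : bool :=
  [&& all (fun e => (e.1 < size (ctrl_arity P)) && (e.2 < size (ctrl_arity P)))
        (ctrl_order P),
      all (fun e => e.1 != e.2) (ctrl_order P) &
      all (fun e => all (fun e' => (e.2 == e'.1) ==> ctrl_lt e.1 e'.2)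
        (ctrl_order P)) (ctrl_order P)].

Definition is_rule (r : rule) : bool :=
  [&& is_state (source r), message (recv r), is_state (target r),
      message (send r) & ctrl_lt (source r).1 (target r).1].

Definition valid : bool :=
  [&& is_strict_order,
      all (fun st => is_state st && ground (state_term st)) (inits P),
      all is_rule (rules P),
      all (fun f => f < size (fn_arity P)) (adv_functions P),
      all (fun c => has_arity (fn_arity P) c 0) (adv_constants P) &
      message (secret P) && ground (secret P)].

Definition single_blind_copying : bool :=
  all (fun r => size (undup (rule_vars r)) <= 1) (rules P).

Definition no_stored_message : bool := all (fun n => n == 0) (ctrl_arity P).

Definition rule_clauses (r : rule) : seq clause :=
  let pre := [:: Reach (state_term (source r)); Known (recv r)] in
  [:: Clause (Known (send r)) pre; Clause (Reach (state_term (target r))) pre].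

Definition adversary_clauses : seq clause :=
  let x := Var 0 in
  let y := Var 1 in
  [:: Clause (Known (encrypt x y)) [:: Known x; Known y];
      Clause (Known x) [:: Known (encrypt x y); Known y];
      Clause (Known (pairing x y)) [:: Known x; Known y];
      Clause (Known x) [:: Known (pairing x y)];
      Clause (Known y) [:: Known (pairing x y)];
      Clause (Known dummy) [::]].

Definition function_clause (f : nat) : clause :=
  let xs := [seq Var i | i <- iota 0 (nth 0 (fn_arity P) f)] in
  Clause (Known (App (Fn f) xs)) [seq Known x | x <- xs].

Definition constant_clause (c : nat) : clause :=
  Clause (Known (App (Fn c) [::])) [::].

Definition clauses : seq clause :=
  [seq Clause (Reach (state_term st)) [::] | st <- inits P] ++
  flatten [seq rule_clauses r | r <- rules P] ++
  adversary_clauses ++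
  [seq function_clause f | f <- adv_functions P] ++
  [seq constant_clause c | c <- adv_constants P].

Definition known_to_adversary (M : term) : Prop :=
  least_herbrand_model universe clauses (Known M).

Definition remains_secret : Prop := ~ known_to_adversary (secret P).

End Instance.

(** * Encoding of instances as binary words *)

(* Numbers are written in unary: binary words for them are shorter and computable
   from the unary ones in polynomial time, so hardness carries over to them. *)
Definition code_nat (n : nat) : seq bool := rcons (nseq n true) false.

Definition code_seq (A : Type) (code : A -> seq bool) (s : seq A) : seq bool :=
  foldr (fun a w => true :: code a ++ w) [:: false] s.

Definition code_pair (A B : Type) (codeA : A -> seq bool) (codeB : B -> seq bool)
    (p : A * B) : seq bool :=
  codeA p.1 ++ codeB p.2.

Definition code_symbol (f : symbol) : seq bool :=
  match f with
  | Enc => code_nat 0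
  | Pair => code_nat 1
  | Dummy => code_nat 2
  | Fn i => code_nat 3 ++ code_nat i
  | Ctrl i => code_nat 4 ++ code_nat i
  end.

Fixpoint code_term (t : term) : seq bool :=
  match t with
  | Var x => false :: code_nat x
  | App f ts => true :: code_symbol f ++ code_seq code_term ts
  end.

Definition code_state : state -> seq bool :=
  code_pair code_nat (code_seq code_term).

Definition code_rule (r : rule) : seq bool :=
  code_state (source r) ++ code_term (recv r) ++
  code_state (target r) ++ code_term (send r).

Definition code_instance (P : instance) : seq bool :=
  code_seq code_nat (fn_arity P) ++
  code_seq code_nat (ctrl_arity P) ++
  code_seq (code_pair code_nat code_nat) (ctrl_order P) ++
  code_seq code_state (inits P) ++
  code_seq code_rule (rules P) ++
  code_seq code_nat (adv_functions P) ++
  code_seq code_nat (adv_constants P) ++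
  code_term (secret P).

Definition prefix_code (A : Type) (code : A -> seq bool) : Prop :=
  forall a b u v, code a ++ u = code b ++ v -> a = b /\ u = v.

Lemma prefix_code_nat : prefix_code code_nat.
Proof.
rewrite /code_nat; elim=> [|m IH] [|n] u v //=; first by case.
by case=> /IH [-> ->].
Qed.

Lemma prefix_code_pair (A B : Type) (codeA : A -> seq bool)
    (codeB : B -> seq bool) :
  prefix_code codeA -> prefix_code codeB -> prefix_code (code_pair codeA codeB).
Proof.
move=> hA hB [a b] [a' b'] u v; rewrite /code_pair /= -!catA.
by case/hA=> -> /hB [-> ->].
Qed.

Lemma prefix_code_seq (A : Type) (code : A -> seq bool) :
  prefix_code code -> prefix_code (code_seq code).
Proof.
move=> h; elim=> [|a s IH] [|b t] u v //=; first by case.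
by case; rewrite -!catA => /h [-> /IH [-> ->]].
Qed.

Lemma prefix_code_symbol : prefix_code code_symbol.
Proof.
case=> [||| i | i] [||| j | j] u v /=; rewrite -?catA /=;
  try (by case); by case=> /prefix_code_nat [-> ->].
Qed.

Lemma prefix_code_term : prefix_code code_term.
Proof.
rewrite /prefix_code; fix IH 1 => -[x|f ts] [y|g us] u v //=.
  by case=> /prefix_code_nat [-> ->].
case; rewrite -!catA => /prefix_code_symbol [-> h].
suff [-> ->] : ts = us /\ u = v by [].
elim: ts us h => [|a s IHs] [|b t] //=; first by case.
by case; rewrite -!catA => /IH [-> /IHs [-> ->]].
Qed.

Lemma prefix_code_state : prefix_code code_state.
Proof.
apply: prefix_code_pair; first exact: prefix_code_nat.
exact/prefix_code_seq/prefix_code_term.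
Qed.

Lemma prefix_code_rule : prefix_code code_rule.
Proof.
rewrite /code_rule; move: code_state prefix_code_state => code hcode.
move=> [a b c d] [a' b' c' d'] u v /=; rewrite -!catA.
by case/hcode=> -> /prefix_code_term [-> /hcode [-> /prefix_code_term [-> ->]]].
Qed.

Lemma code_instance_inj : injective code_instance.
Proof.
have hn := prefix_code_seq prefix_code_nat.
have ho := prefix_code_seq (prefix_code_pair prefix_code_nat prefix_code_nat).
have hi := prefix_code_seq prefix_code_state.
have hr := prefix_code_seq prefix_code_rule.
move=> [a b c d e f g m] [a' b' c' d' e' f' g' m']; rewrite /code_instance /=.
case/hn=> -> /hn [-> /ho [-> /hi [-> /hr [-> /hn [-> /hn [->]]]]]].
by rewrite -[code_term m]cats0 -[code_term m']cats0 => /prefix_code_term [->].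
Qed.

(* The secrecy problem, restricted to the instances in [C], as a language. *)
Definition secrecy_problem (C : pred instance) (w : seq bool) : Prop :=
  exists P : instance,
    [/\ valid P, C P, remains_secret P & w = code_instance P].

(* Main.v *)
From HB Require Import structures.
Require Import Defs.
From mathcomp Require Import all_boot.
From mathcomp Require Import zify.
From Stdlib Require List.

Set Implicit Arguments.
Unset Strict Implicit.
Unset Printing Implicit Defensive.

(* All function symbols of the protocol are unary, and a known message
   [p (x)] is read as the monadic fact "[p] holds of [x]": the adversary can
   only pair and unpair such messages, so that the rules, which receive a tuple
   of facts and send one fact, act as monadic Horn clauses in one variable.
   The ground terms [x] are paths from a root through child functions, and name
   queries to the run of a deterministic machine.  The query [x] carries two
   [m]-bit counters, a time [t] and a depth [k], whose bits are facts about
   [x] computed by ripple-carry from those of the parent.  The machine has a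
   finite control and finitely many stacks (two for each tape of the given
   Turing machine); its control at time [t], and its stacks at time [t] and
   depth [k], are determined by queries with time [t - 1] and depth [0],
   [k - 1], [k] or [k + 1], which are children of [x].  The counters wrap around,
   so the facts are meaningful on the cone [t + k < 2 ^ m] only, which contains
   the root [t = 2 ^ m - 1], [k = 0] and is preserved by the queries that matter.
   The secret is derived from a rejecting control at the root.

   The rules consist of finitely many templates, repeated for each bit and
   each input letter with the indices of some symbols shifted.  They are
   printed by a program in a language of loops over tapes, which is compiled to
   a multi-tape Turing machine. *)

(** * Binary counters *)

Definition low (u : nat -> bool) (v : bool) (i : nat) : bool :=
  all (fun j => u j == v) (iota 0 i).

(** Increment if [v], decrement otherwise: a bit flips exactly when the carry or the borrow reaches
    it, that is, when all lower bits equal [v]. *)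
Definition ripple (v : bool) (u : nat -> bool) (i : nat) : bool :=
  u i (+) low u v i.

Definition binval (m : nat) (u : nat -> bool) : nat := \sum_(i < m) u i * 2 ^ i.

Lemma lowS u v i : low u v i.+1 = (u i == v) && low u v i.
Proof. by rewrite /low -addn1 iotaD all_cat /= andbT andbC. Qed.

Lemma binvalS m u : binval m.+1 u = binval m u + u m * 2 ^ m.
Proof. by rewrite /binval big_ord_recr. Qed.

(** The wrap-around at [2 ^ m] appears as a summand, present exactly when all [m] bits are ones, so
    that the equation holds without truncated subtraction. *)
Lemma binval_incr m u :
  binval m (ripple true u) + low u true m * 2 ^ m = (binval m u).+1.
Proof.
elim: m => [|m IH]; first by rewrite /binval !big_ord0.
rewrite !binvalS lowS expnS [ripple _ _ m]/ripple; move: IH.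
by case: (u m); case: (low u true m) => /=; rewrite ?mul0n ?mul1n; lia.
Qed.

Lemma binval_decr m u :
  (binval m (ripple false u)).+1 = binval m u + low u false m * 2 ^ m.
Proof.
elim: m => [|m IH]; first by rewrite /binval !big_ord0.
rewrite !binvalS lowS expnS [ripple _ _ m]/ripple; move: IH.
by case: (u m); case: (low u false m) => /=; rewrite ?mul0n ?mul1n; lia.
Qed.

(** The zero test is the borrow out of the top bit, so the facts computed for decrementing also
    decide it. *)
Lemma binval_eq0 m u : (binval m u == 0) = low u false m.
Proof.
elim: m => [|m IH]; first by rewrite /binval big_ord0.
rewrite binvalS lowS -IH addn_eq0 muln_eq0 expn_eq0 /= orbF andbC.
by case: (u m).
Qed.

Lemma binval0 m : binval m (fun _ => false) = 0.
Proof. by rewrite /binval big1. Qed.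

Lemma binval_ones m : (binval m (fun _ => true)).+1 = 2 ^ m.
Proof.
elim: m => [|m IH]; first by rewrite /binval big_ord0.
by rewrite binvalS expnS; lia.
Qed.

(** * Stack machines as protocols *)

Inductive action (A : Type) := Keep | Pop | Push of A.
Arguments Keep {A}.
Arguments Pop {A}.

(** [act] depends on the control alone. A cell after a step is thus determined by the control and at
    most one cell before it; only [next_control] inspects the tops of the stacks. *)
Record stack_machine := StackMachine {
  control : finType;
  stack : finType;
  letter : finType;
  start : control;
  input_stack : stack;
  blank : letter;
  letter_of_bit : bool -> letter;
  next_control : control -> {ffun stack -> letter} -> control;
  act : control -> stack -> action letter;
  rejecting : pred control
}.

Section StackRun.
Variable M : stack_machine.

Definition sconfig : Type := (control M * (stack M -> nat -> letter M))%type.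

Definition sinit (w : seq bool) : sconfig :=
  (start M, fun s k =>
    if s == input_stack M then nth (blank M) (map (@letter_of_bit M) w) k
    else blank M).

Definition sstep (x : sconfig) : sconfig :=
  (next_control x.1 [ffun s => x.2 s 0],
   fun s k => match act x.1 s with
     | Keep => x.2 s k
     | Pop => x.2 s k.+1
     | Push a => if k is k'.+1 then x.2 s k' else a
     end).

Definition srun (t : nat) (w : seq bool) : sconfig := iter t sstep (sinit w).

End StackRun.

Section Encoding.
Variable M : stack_machine.
Local Notation C := (control M).
Local Notation S := (stack M).
Local Notation A := (letter M).

(* [None] resets the depth counter, [Some None] keeps it, and [Some (Some v)]
   increments ([v]) or decrements ([~~ v]) it. *)
Definition child : Type := option (option bool).

(* The counter [true] is the time, which every child decrements; [false] is the
   depth. *)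
Definition update_of (c : bool) (o : child) : child :=
  if c then Some (Some false) else o.

Definition update (o : child) (u : nat -> bool) : nat -> bool :=
  match o with
  | None => fun _ => false
  | Some None => u
  | Some (Some v) => ripple v u
  end.

(** Truth values are arguments of the symbols, since Horn clauses cannot test that a fact is absent.
    [Inp i a] concerns the suffix of length [i] of the input word. *)
Inductive symb :=
| Child of child
| Ctl of C
| Cell of S & A
| Zero of bool & bool
| Goal
| Bit of bool & nat & bool
| Low of bool & bool & nat & bool
| Inp of nat & A.

Definition fixed_symb : finType :=
  (child + (C + (S * A + (bool * bool + unit))))%type.
Definition indexed_symb : finType := (bool * bool + (bool * bool * bool + A))%type.

Definition symb_code (y : symb) : fixed_symb + indexed_symb * nat :=
  match y with
  | Child o => inl (inl o)
  | Ctl c => inl (inr (inl c))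
  | Cell s a => inl (inr (inr (inl (s, a))))
  | Zero c b => inl (inr (inr (inr (inl (c, b)))))
  | Goal => inl (inr (inr (inr (inr tt))))
  | Bit c i b => inr (inl (c, b), i)
  | Low c v i d => inr (inr (inl (c, v, d)), i)
  | Inp i a => inr (inr (inr a), i)
  end.

Definition symb_decode (x : fixed_symb + indexed_symb * nat) : symb :=
  match x with
  | inl (inl o) => Child o
  | inl (inr (inl c)) => Ctl c
  | inl (inr (inr (inl (s, a)))) => Cell s a
  | inl (inr (inr (inr (inl (c, b))))) => Zero c b
  | inl (inr (inr (inr (inr tt)))) => Goal
  | inr (inl (c, b), i) => Bit c i b
  | inr (inr (inl (c, v, d)), i) => Low c v i d
  | inr (inr (inr a), i) => Inp i a
  end.

Lemma symb_codeK : cancel symb_code symb_decode.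
Proof. by case. Qed.

HB.instance Definition _ := Equality.copy symb (can_type symb_codeK).

(** Fixed symbols come first; indexed ones follow in layers of [#|indexed_symb|]. Raising an index
    by [j] then adds a multiple of [j] to the number, which in unary is the repetition of a
    block. *)
Definition symb_index (y : symb) : nat :=
  match symb_code y with
  | inl f => enum_rank f
  | inr (g, i) => #|fixed_symb| + (enum_rank g + i * #|indexed_symb|)
  end.

Definition symb_of (n : nat) : option symb :=
  if n < #|fixed_symb| then
    omap (fun f => symb_decode (inl f)) (onth (enum fixed_symb) n)
  else
    let k := n - #|fixed_symb| in
    omap (fun g => symb_decode (inr (g, k %/ #|indexed_symb|)))
      (onth (enum indexed_symb) (k %% #|indexed_symb|)).

Lemma onth_enum_rank (T : finType) (x : T) : onth (enum T) (enum_rank x) = Some x.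
Proof.
by rewrite onthE (nth_map x) -?cardE ?ltn_ord // nth_enum_rank.
Qed.

Lemma indexK : pcancel symb_index symb_of.
Proof.
move=> y; rewrite -[in RHS](symb_codeK y) /symb_index /symb_of.
case: (symb_code y) => [f | [g i]]; first by rewrite ltn_ord onth_enum_rank.
rewrite ltnNge leq_addr /= addKn addnC.
have lt := ltn_ord (enum_rank g).
by rewrite modnMDl modn_small // divnMDl 1?(leq_trans _ lt) // divn_small // addn0
   onth_enum_rank.
Qed.

Definition shift_symb (j : nat) (y : symb) : symb :=
  match y with
  | Bit c i b => Bit c (i + j) b
  | Low c v i d => Low c v (i + j) d
  | Inp i a => Inp (i + j) a
  | _ => y
  end.

Definition shift_index (j n : nat) : nat :=
  if n < #|fixed_symb| then n else n + #|indexed_symb| * j.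

Lemma index_shift j y : symb_index (shift_symb j y) = shift_index j (symb_index y).
Proof.
rewrite /shift_index; case: y => [o|c|s a|c b||c i b|c v i d|i a] /=;
  rewrite /symb_index /= ?ltn_ord // ltnNge leq_addr /= mulnDl (mulnC j); lia.
Qed.

(** * Horn clauses describing the counters and the machine *)

Definition literal : Type := (symb * option child)%type.

(* [(false, h, b)] is the ground instance at the root of [(true, h, b)]. *)
Definition hclause : Type := (bool * literal * seq literal)%type.

Definition shift_literal j (l : literal) : literal := (shift_symb j l.1, l.2).

Definition shift_hclause j (c : hclause) : hclause :=
  (c.1.1, shift_literal j c.1.2, map (shift_literal j) c.2).

Definition here (y : symb) : literal := (y, None).
Definition below (o : child) (y : symb) : literal := (y, Some o).

(** The tops are the cells at depth zero one step earlier, reached by resetting the depth. There is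
    one clause for each control and tuple of tops, a number depending on [M] only. *)
Definition control_hclause (p : C * {ffun S -> A}) : hclause :=
  (true, here (Ctl (next_control p.1 p.2)),
   [:: here (Zero true false), below None (Ctl p.1)
     & [seq below None (Cell s (p.2 s)) | s <- enum S]]).

Definition cell_hclauses (p : C * S * A) : seq hclause :=
  let: (c, s, a) := p in
  let pre := [:: here (Zero true false); below None (Ctl c)] in
  match act c s with
  | Keep => [:: (true, here (Cell s a), rcons pre (below (Some None) (Cell s a)))]
  | Pop => [:: (true, here (Cell s a),
                rcons pre (below (Some (Some true)) (Cell s a)))]
  | Push b => [:: (true, here (Cell s b), rcons pre (here (Zero false true)));
      (true, here (Cell s a),
       pre ++ [:: here (Zero false false); below (Some (Some false)) (Cell s a)])]
  end.

Definition fixed_hclauses : seq hclause :=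
  [seq (true, here (Low p.1 p.2 0 true), [::]) | p <- enum {: bool * bool}] ++
  [:: (true, here (Inp 0 (blank M)), [::]);
      (true, here (Ctl (start M)), [:: here (Zero true true)])] ++
  [seq (true, here (Cell s (blank M)), [:: here (Zero true true)])
     | s <- enum S & s != input_stack M] ++
  [seq control_hclause p | p <- enum {: C * {ffun S -> A}}] ++
  flatten [seq cell_hclauses p | p <- enum {: C * S * A}] ++
  [seq (false, here Goal, [:: here (Ctl c)]) | c <- enum C & rejecting c].

Definition low_hclause (p : bool * bool * bool * bool) : hclause :=
  let: (c, v, b, d) := p in
  (true, here (Low c v 1 ((b == v) && d)), [:: here (Bit c 0 b); here (Low c v 0 d)]).

Definition update_hclause (p : bool * child * bool * bool) : hclause :=
  let: (c, o, b, d) := p in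
  match update_of c o with
  | None => (true, below o (Bit c 0 false), [::])
  | Some None => (true, below o (Bit c 0 b), [:: here (Bit c 0 b)])
  | Some (Some v) =>
      (true, below o (Bit c 0 (b (+) d)), [:: here (Bit c 0 b); here (Low c v 0 d)])
  end.

(** In the ground clauses, [c] is both the counter and the value of its bits: at the root the time
    consists of ones and the depth of zeros. *)
Definition bit_hclauses : seq hclause :=
  [seq (false, here (Bit c 0 c), [::]) | c <- enum {: bool}] ++
  [seq low_hclause p | p <- enum {: bool * bool * bool * bool}] ++
  [seq update_hclause p | p <- enum {: bool * child * bool * bool}].

Definition zero_hclauses : seq hclause :=
  [seq (true, here (Zero p.1 p.2), [:: here (Low p.1 false 0 p.2)])
     | p <- enum {: bool * bool}].

(** Before shifting, index [0] stands for the suffix behind the letter [b] and index [1] for the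
    suffix that begins with it. *)
Definition letter_hclauses (b : bool) : seq hclause :=
  (true, here (Inp 1 (letter_of_bit M b)), [:: here (Zero false true)]) ::
  [seq (true, here (Inp 1 a),
        [:: here (Zero false false); below (Some (Some false)) (Inp 0 a)])
     | a <- enum A].

Definition input_hclauses : seq hclause :=
  [seq (true, here (Cell (input_stack M) a),
        [:: here (Zero true true); here (Inp 0 a)]) | a <- enum A].

(** The clauses of later letters come first, which is the order in which a loop over the stored word
    meets the letters. *)
Fixpoint word_hclauses (w : seq bool) : seq hclause :=
  if w is b :: w' then
    word_hclauses w' ++ map (shift_hclause (size w')) (letter_hclauses b)
  else [::].

Variables (m : nat) (w : seq bool).
Hypothesis size_w : size w <= m.

Definition hclauses : seq hclause :=
  fixed_hclauses ++
  flatten [seq map (shift_hclause i) bit_hclauses | i <- iota 0 m] ++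
  map (shift_hclause m) zero_hclauses ++
  word_hclauses w ++
  map (shift_hclause (size w)) input_hclauses.

(** * Meaning of the facts and soundness of the clauses *)

Definition counters : Type := bool -> nat -> bool.

Definition root_counters : counters := fun c _ => c.

Definition child_counters (o : child) (x : counters) : counters :=
  fun c => update (update_of c o) (x c).

Definition value (x : counters) (c : bool) : nat := binval m (x c).

Definition in_cone (x : counters) : bool := value x true + value x false < 2 ^ m.

Definition goal : bool := rejecting (srun M (2 ^ m).-1 w).1.

(** [Ctl] and [Cell] facts claim something only in the cone, where the counters do not wrap around
    in the relevant queries. A child function never forms a fact. *)
Definition sem (y : symb) (x : counters) : Prop :=
  match y with
  | Child _ => False
  | Ctl c => in_cone x -> (srun M (value x true) w).1 = c
  | Cell s a => in_cone x -> (srun M (value x true) w).2 s (value x false) = a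
  | Zero c b => (value x c == 0) = b
  | Goal => goal
  | Bit c i b => x c i = b
  | Low c v i d => low (x c) v i = d
  | Inp p a => p <= size w ->
      nth (blank M) (map (@letter_of_bit M) (drop (size w - p) w)) (value x false)
      = a
  end.

Definition sem_literal (l : literal) (x : counters) : Prop :=
  sem l.1 (if l.2 is Some o then child_counters o x else x).

Definition sound (c : hclause) : Prop :=
  forall x, (c.1.1 = false -> x = root_counters) ->
  (forall l, l \in c.2 -> sem_literal l x) -> sem_literal c.1.2 x.

Lemma value_root_time : value root_counters true = (2 ^ m).-1.
Proof. by rewrite -binval_ones. Qed.

Lemma value_root_depth : value root_counters false = 0.
Proof. exact: binval0. Qed.

Lemma root_in_cone : in_cone root_counters.
Proof.
by rewrite /in_cone value_root_time value_root_depth addn0 ltn_predL expn_gt0.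
Qed.

Lemma value_child_time o x :
  value x true != 0 -> value x true = (value (child_counters o x) true).+1.
Proof.
rewrite /value binval_eq0 /child_counters /= binval_decr.
by move/negbTE->; rewrite addn0.
Qed.

Lemma value_reset x : value (child_counters None x) false = 0.
Proof. exact: binval0. Qed.

Lemma value_incr x : (value x false).+1 < 2 ^ m ->
  value (child_counters (Some (Some true)) x) false = (value x false).+1.
Proof.
rewrite /value /child_counters /= -(binval_incr m).
by case: low; rewrite ?mul1n ?mul0n ?addn0 //; lia.
Qed.

Lemma value_decr x : value x false != 0 ->
  value x false = (value (child_counters (Some (Some false)) x) false).+1.
Proof.
rewrite /value binval_eq0 /child_counters /= binval_decr.
by move/negbTE->; rewrite addn0.
Qed.

Lemma sound_fixed : {in fixed_hclauses, forall c, sound c}.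
Proof.
move=> c; rewrite !mem_cat => /orP[/mapP[p _ ->]|]; first by move=> x _ _.
rewrite !inE => /orP[/orP[]/eqP-> |].
- by move=> x _ _ _; rewrite subn0 drop_size nth_nil.
- by move=> x _ /(_ _ (mem_head _ _)) /= /eqP z _; rewrite z.
case/orP=> [/mapP[s]|].
  rewrite mem_filter => /andP[/negbTE ns _] -> x _ /(_ _ (mem_head _ _)) /=.
  by move=> /eqP z _; rewrite z /= ns.
case/orP=> [/mapP[[c1 g] _ ->] x _ h|].
  have /negbT nz : sem (Zero true false) x := h _ (mem_head _ _).
  have hc := h (below None (Ctl c1)); rewrite !inE eqxx orbT /= in hc.
  move: hc => /(_ isT) hc /= cone.
  have tS := value_child_time None nz.
  (* The time drops by one and the depth drops to zero, so the sum cannot grow. *)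
  have cone' : in_cone (child_counters None x).
    by move: cone; rewrite /in_cone tS value_reset; lia.
  rewrite tS /= (hc cone'); congr next_control; apply/ffunP => s; rewrite ffunE.
  have /h /(_ cone') : below None (Cell s (g s)) \in (control_hclause (c1, g)).2.
    rewrite !inE; apply/orP; right; apply/orP; right.
    by apply: (map_f (fun s => below None (Cell s (g s)))); rewrite mem_enum.
  by rewrite /= value_reset.
case/orP=> [/flattenP[cs /mapP[[[c1 s] a] _ ->]]|/mapP[c1]]; last first.
  rewrite mem_filter => /andP[rc _] -> x /= /(_ erefl) -> /(_ _ (mem_head _ _)).
  by move=> /(_ root_in_cone) e; rewrite /sem_literal /= /goal -value_root_time e.
move=> hcs.
(* The premises shared by all actions. The control is read at the child that resets the depth, but
   all children have the same time, so the conclusion holds for any child [o]. *)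
have pre x : (forall l, l \in [:: here (Zero true false); below None (Ctl c1)] ->
    sem_literal l x) -> in_cone x ->
    value x true != 0 /\ forall k o, value (child_counters o x) true = k ->
      (srun M k w).1 = c1.
  move=> h cone.
  have /negbT nz : sem (Zero true false) x := h _ (mem_head _ _).
  split=> // k o <-; have tS := value_child_time None nz.
  rewrite -[value _ _]/(value (child_counters None x) true).
  have := h (below None (Ctl c1)); rewrite !inE eqxx orbT => /(_ isT); apply.
  by move: cone; rewrite /in_cone tS value_reset /=; lia.
move: hcs; rewrite /cell_hclauses; case e: (act c1 s) => [||b].
- rewrite inE => /eqP-> x _ h; rewrite /sem_literal /= => cone.
  case: (pre x) => // [l hl|nz hk]; first by apply: h; rewrite mem_rcons inE hl orbT.
  have tS := value_child_time (Some None) nz.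
  rewrite tS /= (hk _ _ erefl) e.
  have := h (below (Some None) (Cell s a)); rewrite mem_rcons mem_head.
  have kS : value (child_counters (Some None) x) false = value x false by [].
  by apply=> //; move: cone; rewrite /in_cone tS /= kS; lia.
- rewrite inE => /eqP-> x _ h; rewrite /sem_literal /= => cone.
  case: (pre x) => // [l hl|nz hk]; first by apply: h; rewrite mem_rcons inE hl orbT.
  have tS := value_child_time (Some (Some true)) nz.
  (* In the cone a positive time leaves room for one more unit of depth below [2 ^ m], so the
     increment does not overflow. *)
  have kS : value (child_counters (Some (Some true)) x) false = (value x false).+1.
    by apply: value_incr; move: cone; rewrite /in_cone tS; lia.
  rewrite tS /= (hk _ _ erefl) e -kS.
  have := h (below (Some (Some true)) (Cell s a)); rewrite mem_rcons mem_head.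
  by apply=> //; move: cone; rewrite /in_cone tS kS /=; lia.
rewrite !inE => /orP[]/eqP-> x _ h; rewrite /sem_literal /= => cone.
  case: (pre x) => // [l hl|nz hk]; first by apply: h; rewrite mem_rcons inE hl orbT.
  have tS := value_child_time None nz.
  rewrite tS /= (hk _ _ erefl) e.
  have /eqP -> // : sem (Zero false true) x.
  by apply: (h (here (Zero false true))); rewrite mem_rcons mem_head.
case: (pre x) => // [l hl|nz hk]; first by apply: h; rewrite mem_cat hl.
have tS := value_child_time (Some (Some false)) nz.
rewrite tS /= (hk _ _ erefl) e.
have /negbT kn : sem (Zero false false) x.
  by apply: (h (here (Zero false false))); rewrite !inE eqxx !orbT.
have kS := value_decr kn; rewrite kS.
have := h (below (Some (Some false)) (Cell s a)); rewrite !inE eqxx !orbT => /(_ isT).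
by apply=> //; move: cone; rewrite /in_cone tS kS /=; lia.
Qed.

Lemma sound_bit i c : c \in bit_hclauses -> sound (shift_hclause i c).
Proof.
rewrite !mem_cat => /orP[/mapP[b _ ->] x /(_ erefl) -> //|].
case/orP=> /mapP[[[[b1 b2] b3] b4] _ ->] x _ /=.
  move=> h; have /= := h _ (mem_head _ _); rewrite /sem_literal /= => e.
  have := h (here (Low b1 b2 i b4)); rewrite !inE eqxx orbT => /(_ isT) e'.
  by rewrite lowS e e'.
rewrite /update_hclause; case e: (update_of b1 b2) => [[v|]|] h.
- have e1 : x b1 i = b3 := h _ (mem_head _ _).
  have e2 : low (x b1) v i = b4.
    by apply: (h (here (Low b1 v i b4))); rewrite !inE eqxx orbT.
  by rewrite /sem_literal /= /child_counters e /= /ripple e1 e2.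
- have e1 : x b1 i = b3 := h _ (mem_head _ _).
  by rewrite /sem_literal /= /child_counters e.
- by rewrite /sem_literal /= /child_counters e.
Qed.

Lemma sound_zero c : c \in zero_hclauses -> sound (shift_hclause m c).
Proof.
case/mapP=> [[c1 b] _ ->] x _ /(_ _ (mem_head _ _)).
by rewrite /sem_literal /= /value binval_eq0.
Qed.

(** The induction moves letters from the front of [v] to the end of [u], so that [v] remains the
    suffix of [w] to which [Inp (size v)] refers. *)
Lemma sound_word u v : u ++ v = w -> {in word_hclauses v, forall c, sound c}.
Proof.
elim: v u => [|b v IH] u // e c; rewrite mem_cat => /orP[]; first last.
  have sw : size w = size u + (size v).+1 by rewrite -e size_cat.
  have dS : drop (size w - (size v).+1) w = b :: v.
    by rewrite sw addnK -e drop_size_cat.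
  case/mapP=> c'; rewrite inE => /orP[/eqP-> ->|/mapP[a _ ->] ->] x _ h;
    rewrite /sem_literal /= => _; rewrite dS /=.
    by have /eqP-> : sem (Zero false true) x := h _ (mem_head _ _).
  have /negbT nz : sem (Zero false false) x := h _ (mem_head _ _).
  rewrite (value_decr nz) /=.
  have := h (below (Some (Some false)) (Inp (size v) a)).
  rewrite !inE eqxx orbT => /(_ isT); rewrite /sem_literal /=.
  have -> : drop (size w - size v) w = v.
    by rewrite sw addnS -addSn addnK -e -cat_rcons drop_size_cat ?size_rcons.
  by apply; rewrite sw; lia.
by apply: (IH (rcons u b)); rewrite cat_rcons.
Qed.

Lemma sound_input c : c \in input_hclauses -> sound (shift_hclause (size w) c).
Proof.
case/mapP=> a _ -> x _ h; rewrite /sem_literal /= => _.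
have /eqP-> : sem (Zero true true) x := h _ (mem_head _ _).
have := h (here (Inp (size w) a)); rewrite !inE eqxx orbT => /(_ isT).
by rewrite /sem_literal /= subnn drop0 eqxx; apply.
Qed.

Lemma mem_hclauses c : (c \in hclauses) =
  [|| c \in fixed_hclauses,
      c \in flatten [seq map (shift_hclause i) bit_hclauses | i <- iota 0 m],
      c \in map (shift_hclause m) zero_hclauses,
      c \in word_hclauses w
    | c \in map (shift_hclause (size w)) input_hclauses].
Proof.
rewrite /hclauses (mem_cat c fixed_hclauses) (mem_cat c (flatten _)).
by rewrite (mem_cat c (map _ zero_hclauses)) (mem_cat c (word_hclauses _)).
Qed.

Lemma sound_hclauses : {in hclauses, forall c, sound c}.
Proof.
move=> c; rewrite mem_hclauses => /orP[h|]; first exact: sound_fixed.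
case/or4P=> [/flattenP[cs /mapP[i _ ->] /mapP[c' h ->]]|/mapP[c' h ->]|h
  |/mapP[c' h ->]].
- exact: sound_bit.
- exact: sound_zero.
- exact: (@sound_word [::] w).
- exact: sound_input.
Qed.

(** * The protocol and the invariant of the adversary's knowledge *)

Definition fn (n : nat) (t : term) : term := App (Fn n) [:: t].

Definition literal_term (l : literal) (x : term) : term :=
  fn (symb_index l.1) (if l.2 is Some o then fn (symb_index (Child o)) x else x).

(** Control point [0] is always reachable, so every rule fires without restriction. The body is
    received as nested pairs closed by the public [dummy], which also serves as the root of all
    paths. *)
Definition rule_of (c : hclause) : rule :=
  let x := if c.1.1 then Var 0 else dummy in
  Rule (0, [::]) (foldr (fun l t => pairing (literal_term l x) t) dummy c.2)
       (1, [::]) (literal_term c.1.2 x).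

(** Indices run from [0] to [m] inclusive, since [Low] at index [m] covers all [m] bits. The sum is
    split in the way in which the arities are printed. *)
Definition fn_count : nat := #|fixed_symb| + #|indexed_symb| + #|indexed_symb| * m.

Definition protocol : instance := {|
  fn_arity := nseq fn_count 1;
  ctrl_arity := [:: 0; 0];
  ctrl_order := [:: (0, 1)];
  inits := [:: (0, [::])];
  rules := map rule_of hclauses;
  adv_functions := [::];
  adv_constants := [::];
  secret := fn (symb_index Goal) dummy
|}.

(** The variable of a rule may be instantiated by any ground term, also by one that is no path. Such
    terms get the root counters by default, which is harmless because non-ground clauses are sound
    for all counters. *)
Fixpoint counters_of (t : term) : counters :=
  if t is App (Fn n) [:: u] then
    if symb_of n is Some (Child o) then child_counters o (counters_of u)
    else root_counters
  else root_counters.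

Fixpoint safe (t : term) : Prop :=
  match t with
  | App Dummy [::] => True
  | App Enc [:: a; b] | App Pair [:: a; b] => safe a /\ safe b
  | App (Fn n) [:: u] =>
      if symb_of n is Some y then sem y (counters_of u) else False
  | _ => False
  end.

Lemma safe_literal l t : safe (literal_term l t) <-> sem_literal l (counters_of t).
Proof. by case: l => y [o|]; rewrite /sem_literal /= ?indexK. Qed.

Lemma In_cat (T : Type) (s1 s2 : seq T) x :
  List.In x (s1 ++ s2) <-> List.In x s1 \/ List.In x s2.
Proof. exact: List.in_app_iff. Qed.

Lemma In_flatten_map (T U : Type) (f : T -> seq U) s x :
  List.In x (flatten (map f s)) <-> exists a, List.In a s /\ List.In x (f a).
Proof.
elim: s => [|a s IH] /=; first by split=> // -[? []].
rewrite In_cat IH; split=> [[h|[b [h1 h2]]]|[b [[<-|h1] h2]]].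
- by exists a; split=> //; left.
- by exists b; split=> //; right.
- by left.
- by right; exists b.
Qed.

Lemma In_mem (T : eqType) (x : T) (s : seq T) : List.In x s <-> x \in s.
Proof.
elim: s => [|y s IH] //=; rewrite inE; split.
  by case=> [->|/IH ->]; rewrite ?eqxx ?orbT.
by case/orP=> [/eqP->|/IH]; [left|right].
Qed.

Lemma In_protocol_rules r :
  List.In r (rules protocol) -> exists2 c, c \in hclauses & r = rule_of c.
Proof. by case/List.in_map_iff=> c [<- /In_mem h]; exists c. Qed.

Lemma known_goal : known_to_adversary protocol (secret protocol) -> goal.
Proof.
(* The least model is contained in this one. Pairs and ciphertexts are safe when both components
   are, hence projection and decryption preserve safety. *)
pose I a := if a is Known t then safe t else True.
move/(_ I) => h; suff /h : herbrand_model (universe protocol) (clauses protocol) I.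
  by rewrite /= indexK.
move=> c s + _; rewrite /clauses !In_cat => -[|[|[|[]//]]].
- by case=> // <-.
- case/In_flatten_map=> r [/In_protocol_rules[cl hcl ->]].
  set x := if cl.1.1 then s 0 else dummy.
  have sub l : subst s (literal_term l (if cl.1.1 then Var 0 else dummy))
      = literal_term l x.
    by rewrite /literal_term /x; case: cl.1.1; case: l.2.
  case=> [|[]] // <- // hb.
  suff : safe (literal_term cl.1.2 x) by rewrite -sub.
  apply/safe_literal/(sound_hclauses hcl).
    by rewrite /x => ->.
  move=> l hl; apply/safe_literal; rewrite -sub.
  have := hb (Known (recv (rule_of cl))) (or_intror (or_introl erefl)).
  rewrite /=; elim: cl.2 hl => //= l' ls IH; rewrite inE.
  by case/orP=> [/eqP->|/IH h'] [].
case=> [<- hb|[<- hb|[<- hb|[<- hb|[<- hb|[<- //|//]]]]]].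
- by split; [exact: (hb _ (or_introl erefl))
            | exact: (hb _ (or_intror (or_introl erefl)))].
- by have [] := hb _ (or_introl erefl).
- by split; [exact: (hb _ (or_introl erefl))
            | exact: (hb _ (or_intror (or_introl erefl)))].
- by have [] := hb _ (or_introl erefl).
- by have [] := hb _ (or_introl erefl).
Qed.

(** * Bounds on the indices of symbols *)

Definition level (y : symb) : nat :=
  match y with Bit _ i _ | Low _ _ i _ | Inp i _ => i | _ => 0 end.

Definition bounded (k : nat) (c : hclause) : bool :=
  all (fun l => level l.1 <= k) (c.1.2 :: c.2).

Lemma bounded_shift j k c : bounded k c -> bounded (k + j) (shift_hclause j c).
Proof.
case: c => [[b h] ls]; rewrite /bounded /= all_map => /andP[hh /allP hb].
have lv y : level y <= k -> level (shift_symb j y) <= k + j.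
  by case: y => //= *; rewrite leq_add2r.
by rewrite lv //; apply/allP => l /hb; apply: lv.
Qed.

Lemma boundedW k k' c : k <= k' -> bounded k c -> bounded k' c.
Proof. by move=> le; apply: sub_all => l h; apply: leq_trans le. Qed.

Lemma bounded_fixed : all (bounded 0) fixed_hclauses.
Proof.
rewrite !all_cat !all_map; apply/and5P; split; [exact/allP|by []|exact/allP|..].
  by apply/allP => -[c g] _; rewrite /= /bounded /= all_map; apply/allP.
apply/andP; split; last exact/allP.
apply/allP => cl /flattenP[cls /mapP[[[c s] a] _ ->]].
by move: cl; apply/allP => /=; case: (act c s).
Qed.

Lemma bounded_bit : all (bounded 1) bit_hclauses.
Proof.
rewrite !all_cat !all_map; apply/and3P; split; apply/allP => //.
  by move=> [[[]]].
by move=> [[[c o] b] d] _; rewrite /= /update_hclause; case: update_of => [[v|]|].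
Qed.

(** Bit templates of level [1] are shifted by less than [m], letter templates by less than [size w],
    and the remaining ones, of level [0], by at most [m]. *)
Lemma bounded_hclauses : all (bounded m) hclauses.
Proof.
have sh k j s : k + j <= m -> all (bounded k) s ->
    all (bounded m) (map (shift_hclause j) s).
  move=> le; rewrite all_map; apply: sub_all => c /(bounded_shift j).
  exact: boundedW.
rewrite (all_cat _ fixed_hclauses) (all_cat _ (flatten _)).
rewrite (all_cat _ (map _ zero_hclauses)) (all_cat _ (word_hclauses _)).
apply/and5P; split.
- by apply: (sub_all _ bounded_fixed) => c; apply: boundedW.
- apply/allP => c /flattenP[cs /mapP[i]]; rewrite mem_iota => lt ->.
  by move: c; apply/allP/(sh 1 i) => //; exact: bounded_bit.
- by apply: (sh 0) => //; rewrite all_map; apply/allP.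
- elim: w size_w => // b v IH lt; rewrite [word_hclauses _]/= all_cat.
  rewrite IH 1?ltnW // andTb; apply: (sh 1 _ (letter_hclauses b)) => //=.
  rewrite all_map.
  by apply/allP.
- by apply: (sh 0) => //; rewrite all_map; apply/allP.
Qed.

Lemma has_arity_index y : level y <= m ->
  has_arity (fn_arity protocol) (symb_index y) 1.
Proof.
move=> le; rewrite /has_arity /= size_nseq nth_nseq.
suff -> : symb_index y < fn_count by [].
rewrite /symb_index /fn_count -addnA -mulnS.
have fixed_lt (f : fixed_symb) : enum_rank f < #|fixed_symb| + #|indexed_symb| * m.+1.
  by rewrite ltn_addr.
have indexed_lt (g : indexed_symb) i : i <= m ->
    #|fixed_symb| + (enum_rank g + i * #|indexed_symb|)
    < #|fixed_symb| + #|indexed_symb| * m.+1.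
  move=> le'; rewrite ltn_add2l mulnS [#|_| * m]mulnC -addSn.
  by apply: leq_add; rewrite ?leq_mul2r ?le' ?orbT.
by case: y le => [o|c|s a|c b||c i b|c v i d|i a] /= le;
  first [exact: fixed_lt | exact: indexed_lt].
Qed.

(** * Completeness: the true facts on paths hold in every model *)

Section Completeness.
Variable I : atom -> Prop.
Hypothesis model : herbrand_model (universe protocol) (clauses protocol) I.

Definition path_term (p : seq child) : term :=
  foldr (fun o t => fn (symb_index (Child o)) t) dummy p.

Definition path_counters (p : seq child) : counters :=
  foldr child_counters root_counters p.

Definition derived (y : symb) (p : seq child) : Prop :=
  I (Known (fn (symb_index y) (path_term p))).

Definition derived_literal (l : literal) (p : seq child) : Prop :=
  derived l.1 (if l.2 is Some o then o :: p else p).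

Lemma universe_fn y t : level y <= m -> universe protocol t ->
  universe protocol (fn (symb_index y) t).
Proof.
move=> le /andP[wf gr]; rewrite /universe /= has_arity_index //= wf.
by rewrite /ground /= cats0.
Qed.

Lemma universe_pairing t u : universe protocol t -> universe protocol u ->
  universe protocol (pairing t u).
Proof.
case/andP=> wt gt /andP[wu gu]; rewrite /universe /= wt wu /=.
by move: gt gu; rewrite /ground /= cats0 /nilp size_cat => /eqP-> /eqP->.
Qed.

Lemma universe_path p : universe protocol (path_term p).
Proof. by elim: p => //= o p IH; apply: universe_fn. Qed.

Lemma universe_literal l p : level l.1 <= m ->
  universe protocol (literal_term l (path_term p)).
Proof.
case: l => y [o|] le; apply: universe_fn => //; last exact: universe_path.
exact: (universe_path (o :: p)).
Qed.

Lemma literal_term_path l p :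
  literal_term l (path_term p)
  = fn (symb_index l.1) (path_term (if l.2 is Some o then o :: p else p)).
Proof. by case: l => y [o|]. Qed.

Lemma derive c p : c \in hclauses -> (c.1.1 = false -> p = [::]) ->
  {in c.2, forall l, derived_literal l p} -> derived_literal c.1.2 p.
Proof.
move=> hc ground_c hb; have /= /andP[_ lv] := allP bounded_hclauses _ hc.
pose s := fun i : nat => path_term p.
have sub l : subst s (literal_term l (if c.1.1 then Var 0 else dummy))
    = literal_term l (path_term p).
  rewrite /literal_term; case: c.1.1 ground_c => [|/(_ erefl) ->]; by case: l.2.
have adv cl : List.In cl adversary_clauses -> List.In cl (clauses protocol).
  by move=> h; rewrite /clauses !In_cat; right; right; left.
have rl cl : List.In cl (rule_clauses (rule_of c)) -> List.In cl (clauses protocol).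
  move=> h; rewrite /clauses !In_cat; right; left; apply/In_flatten_map.
  exists (rule_of c); split=> //; apply/List.in_map_iff; exists c; split=> //.
  exact/In_mem.
have known_head := model (rl _ (or_introl erefl)) (s := s) (fun=> universe_path p).
rewrite /derived_literal /derived -literal_term_path -sub; apply: known_head.
move=> b [<-|[<-|//]].
  have h := @model (Clause (Reach (state_term (0, [::]))) [::]) s.
  apply: h; [|by move=> x; apply: universe_path|by []].
  by rewrite /clauses !In_cat; left; left.
(* The pairing clause may be instantiated only with terms of the Herbrand universe, so membership in
   it is carried through the induction on the body. *)
suff: universe protocol (subst s (recv (rule_of c))) /\
    I (Known (subst s (recv (rule_of c)))) by case.
rewrite [recv _]/=; set x := if c.1.1 then _ else _ in sub *.
elim: c.2 lv hb => [_ _|l ls IH /andP[le lv] hb].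
  split=> //; apply: (@model (Clause (Known dummy) [::]) s) => //.
    by apply: adv; do 5 right; left.
  by move=> j; apply: universe_path.
have [|ut it] := IH lv; first by move=> l' hl; apply: hb; rewrite inE hl orbT.
have ul := universe_literal p le.
have il : I (Known (literal_term l (path_term p))).
  by rewrite literal_term_path; apply: hb; apply: mem_head.
rewrite -[subst s _]/(pairing (subst s (literal_term l x)) (subst s
  (foldr (fun l t => pairing (literal_term l x) t) dummy ls))) sub.
set t := subst s _ in ut it *; set u := literal_term l _ in ul il *.
split.
  exact: universe_pairing.
have h := @model
  (Clause (Known (pairing (Var 0) (Var 1))) [:: Known (Var 0); Known (Var 1)])
  (fun i => if i is 0 then u else t).
apply: h => [|[|j] //|b'].
  by apply: adv; do 2 right; left.
by case=> [<- //|[<- //|]].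
Qed.

Lemma derive_fixed c p : c \in fixed_hclauses -> (c.1.1 = false -> p = [::]) ->
  {in c.2, forall l, derived_literal l p} -> derived_literal c.1.2 p.
Proof. by move=> h; apply: derive; rewrite mem_hclauses h. Qed.

Lemma derive_bit i c p : i < m -> c \in bit_hclauses -> (c.1.1 = false -> p = [::]) ->
  {in map (shift_literal i) c.2, forall l, derived_literal l p} ->
  derived_literal (shift_literal i c.1.2) p.
Proof.
move=> lt h; apply: (derive (c := shift_hclause i c)); rewrite mem_hclauses.
apply/orP; right; apply/orP; left; apply/flattenP.
exists (map (shift_hclause i) bit_hclauses); last exact: map_f.
by apply: (map_f (fun i => map (shift_hclause i) bit_hclauses)); rewrite mem_iota.
Qed.

(** The bits are a hypothesis because [derived_bit] applies this lemma at the parent node in the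
    middle of its own induction on the path. *)
Lemma derived_low c v i p :
  (forall j, j < m -> derived (Bit c j (path_counters p c j)) p) -> i <= m ->
  derived (Low c v i (low (path_counters p c) v i)) p.
Proof.
move=> hb; elim: i => [_|i IH lt].
  apply: (derive_fixed (c := (true, here (Low c v 0 true), [::]))) => //.
  rewrite mem_cat; apply/orP; left.
  by apply: (map_f (fun p => (true, here (Low p.1 p.2 0 true), [::])) (x := (c, v)));
    rewrite mem_enum.
rewrite lowS; set b := path_counters p c i; set d := low _ v i.
apply: (@derive_bit i (low_hclause (c, v, b, d)) p) => //.
  by rewrite !mem_cat (map_f low_hclause) ?orbT ?mem_enum.
move=> l; rewrite !inE => /orP[]/eqP->; first exact: hb.
exact: IH (ltnW lt).
Qed.

Lemma derived_bit c i p : i < m -> derived (Bit c i (path_counters p c i)) p.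
Proof.
elim: p i => [|o p IH] i lt.
  apply: (@derive_bit i (false, here (Bit c 0 c), [::]) [::]) => //.
  by rewrite mem_cat (map_f (fun c => (false, here (Bit c 0 c), [::]))) ?mem_enum.
have mem b d : update_hclause (c, o, b, d) \in bit_hclauses.
  by rewrite !mem_cat (map_f update_hclause) ?orbT ?mem_enum.
rewrite /= /child_counters.
have := mem (path_counters p c i).
case e : (update_of c o) => [[v|]|] /=; rewrite e => mem'.
- have := @derive_bit i _ p lt (mem' (low (path_counters p c) v i)); apply=> //.
  move=> l; rewrite !inE => /orP[]/eqP->; first exact: IH.
  by apply: derived_low (ltnW lt) => j; apply: IH.
(* Without a carry the clause does not depend on the last component of its parameter; [true] is an
   arbitrary choice. *)
- have := @derive_bit i _ p lt (mem' true); apply=> //.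
  by move=> l; rewrite !inE => /eqP->; apply: IH.
- by have := @derive_bit i _ p lt (mem' true); apply.
Qed.

Lemma derived_zero c p : derived (Zero c (value (path_counters p) c == 0)) p.
Proof.
rewrite /value binval_eq0; set b := low _ _ _.
apply: (@derive (true, here (Zero c b), [:: here (Low c false m b)]) p) => //.
  rewrite mem_hclauses.
  rewrite (map_f (shift_hclause m)
    (x := (true, here (Zero c b), [:: here (Low c false 0 b)]))) ?orbT //.
  by apply: (map_f (fun p => (true, here (Zero p.1 p.2),
    [:: here (Low p.1 false 0 p.2)])) (x := (c, b))); rewrite mem_enum.
move=> l; rewrite !inE => /eqP->; apply: derived_low => // j.
exact: derived_bit.
Qed.

Lemma derived_zeroN c p : value (path_counters p) c != 0 -> derived (Zero c false) p.
Proof. by move/negbTE<-; apply: derived_zero. Qed.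

Lemma derived_zero0 c p : value (path_counters p) c = 0 -> derived (Zero c true) p.
Proof. by move=> e; have := derived_zero c p; rewrite e. Qed.

(** Each letter is skipped by passing to the child of smaller depth. The time may wrap around
    meanwhile, which does not affect the depth. *)
Lemma derived_inp u v p : u ++ v = w ->
  derived (Inp (size v)
    (nth (blank M) (map (@letter_of_bit M) v) (value (path_counters p) false))) p.
Proof.
move=> e; have sub c : c \in word_hclauses v -> c \in hclauses.
  move=> h; rewrite mem_hclauses.
  suff -> : c \in word_hclauses w by rewrite !orbT.
  by rewrite -e; elim: u {e} => //= b u IH; rewrite mem_cat IH.
elim: v u e sub p => [|b v IH] u e sub p.
  rewrite nth_nil.
  by apply: (@derive_fixed (true, here (Inp 0 (blank M)), [::])) => //;
    rewrite mem_cat mem_cat inE eqxx /= orbT.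
case: (eqVneq (value (path_counters p) false) 0) => [z|nz].
  rewrite z; apply: (@derive (shift_hclause (size v) (true,
    here (Inp 1 (letter_of_bit M b)), [:: here (Zero false true)])) p) => //.
    by apply: sub; rewrite mem_cat map_f ?orbT ?mem_head.
  by move=> l; rewrite !inE => /eqP->; apply: derived_zero0.
rewrite (value_decr nz) -/(path_counters (Some (Some false) :: p)).
rewrite [nth _ _ _]/=; set a := nth _ _ _.
apply: (@derive (shift_hclause (size v) (true, here (Inp 1 a),
        [:: here (Zero false false); below (Some (Some false)) (Inp 0 a)])) p) => //.
  apply: sub; rewrite mem_cat map_f ?orbT // inE; apply/orP; right.
  by apply: (map_f (fun a => (true, here (Inp 1 a), [:: here (Zero false false);
    below (Some (Some false)) (Inp 0 a)]))); rewrite mem_enum.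
move=> l; rewrite !inE => /orP[]/eqP->; first exact: derived_zeroN.
apply: (IH (rcons u b) _ _ (Some (Some false) :: p)); first by rewrite cat_rcons.
by move=> c h; apply: sub; rewrite mem_cat h.
Qed.

(** Induction on the time, over all paths at once: the step queries several children, each of them
    again in the cone and at time [t]. *)
Lemma derived_run t p : value (path_counters p) true = t ->
  in_cone (path_counters p) ->
  derived (Ctl (srun M t w).1) p /\
  forall s, derived (Cell s ((srun M t w).2 s (value (path_counters p) false))) p.
Proof.
elim: t p => [|t IH] p et cone.
  have z := derived_zero0 et.
  split.
    apply: (@derive_fixed (true, here (Ctl (start M)), [:: here (Zero true true)]) p).
    - by rewrite mem_cat mem_cat !inE eqxx !orbT.
    - by [].
    - by move=> l; rewrite !inE => /eqP->.
  move=> s; rewrite /=; case: eqP => [->|/eqP ns].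
    set a := nth _ _ _.
    apply: (@derive (shift_hclause (size w) (true, here (Cell (input_stack M) a),
        [:: here (Zero true true); here (Inp 0 a)])) p) => //.
      rewrite mem_hclauses (map_f (shift_hclause (size w))) ?orbT //.
      by apply: (map_f (fun a => (true, here (Cell (input_stack M) a),
        [:: here (Zero true true); here (Inp 0 a)]))); rewrite mem_enum.
    move=> l; rewrite !inE => /orP[]/eqP-> //.
    exact: (@derived_inp [::]).
  apply: (@derive_fixed (true, here (Cell s (blank M)), [:: here (Zero true true)]) p).
  - rewrite mem_cat mem_cat mem_cat.
    rewrite (map_f (fun s => (true, here (Cell s (blank M)),
      [:: here (Zero true true)]))) ?orbT //.
    by rewrite mem_filter ns mem_enum.
  - by [].
  - by move=> l; rewrite !inE => /eqP->.
have nz : value (path_counters p) true != 0 by rewrite et.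
have zt := derived_zeroN nz.
have ch o : value (path_counters (o :: p)) true = t.
  by apply/succn_inj; rewrite -et (value_child_time o nz).
have reset : in_cone (path_counters (None :: p)).
  by move: cone; rewrite /in_cone ch et [path_counters _]/= value_reset; lia.
have [hc hs] := IH _ (ch None) reset.
rewrite value_reset in hs.
set x := srun M t w in hc hs *.
split.
  pose g := [ffun s => x.2 s 0].
  apply: (@derive_fixed (control_hclause (x.1, g)) p) => //.
    rewrite mem_cat mem_cat mem_cat mem_cat (map_f control_hclause) ?orbT //.
    by rewrite mem_enum.
  move=> l; rewrite !inE => /orP[/eqP-> //|/orP[/eqP-> //|]].
  by case/mapP=> s _ ->; rewrite /= /g ffunE; apply: hs.
move=> s; rewrite /srun iterS -/(srun M t w) -/x.
have cell a c : c \in cell_hclauses (x.1, s, a) ->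
    (c.1.1 = false -> p = [::]) ->
    {in c.2, forall l, derived_literal l p} -> derived_literal c.1.2 p.
  move=> h; apply: derive_fixed; rewrite mem_cat mem_cat mem_cat mem_cat mem_cat.
  suff -> : c \in flatten [seq cell_hclauses p | p <- enum {: C * S * A}].
    by rewrite !orbT.
  apply/flattenP; exists (cell_hclauses (x.1, s, a)) => //.
  by rewrite (map_f cell_hclauses) ?mem_enum.
move: cell; rewrite /cell_hclauses /=; case: (act x.1 s) => [||b] cell.
- have := cell (x.2 s (value (path_counters p) false)) _ (mem_head _ _); apply=> //.
  move=> l; rewrite !inE => /orP[/eqP-> //|/orP[/eqP-> //|/eqP->]].
  have [|_ h] := IH (Some None :: p) (ch _); last exact: h.
  have kS : value (path_counters (Some None :: p)) false
      = value (path_counters p) false by [].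
  by move: cone; rewrite /in_cone ch et kS; lia.
- have kS : value (path_counters (Some (Some true) :: p)) false
      = (value (path_counters p) false).+1.
    by apply: (@value_incr (path_counters p)); move: cone; rewrite /in_cone et; lia.
  rewrite -kS; have := cell (x.2 s _) _ (mem_head _ _); apply=> //.
  move=> l; rewrite !inE => /orP[/eqP-> //|/orP[/eqP-> //|/eqP->]].
  have [|_ h] := IH (Some (Some true) :: p) (ch _); last exact: h.
  by move: cone; rewrite /in_cone ch et kS; lia.
case: (eqVneq (value (path_counters p) false) 0) => [z|nzk].
  rewrite z; have := cell b _ (mem_head _ _); apply=> //.
  move=> l; rewrite !inE => /orP[/eqP-> //|/orP[/eqP-> //|/eqP->]].
  exact: derived_zero0.
rewrite (value_decr nzk) -/(path_counters (Some (Some false) :: p)).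
set a := x.2 s _.
have := cell a (true, here (Cell s a), [:: here (Zero true false); below None (Ctl x.1);
  here (Zero false false); below (Some (Some false)) (Cell s a)]); apply=> //.
  by rewrite !inE eqxx orbT.
move=> l; rewrite !inE => /or4P[/eqP-> //|/eqP-> //|/eqP->|/eqP->].
  exact: derived_zeroN.
have [|_ h] := IH (Some (Some false) :: p) (ch _); last exact: h.
have kS : value (path_counters p) false
    = (value (path_counters (Some (Some false) :: p)) false).+1 := value_decr nzk.
by move: cone; rewrite /in_cone ch et kS; lia.
Qed.

Lemma derived_goal : goal -> I (Known (secret protocol)).
Proof.
rewrite /goal; set c := (srun M _ w).1 => rc.
apply: (@derive_fixed (false, here Goal, [:: here (Ctl c)]) [::]) => //.
  rewrite !mem_cat (map_f (fun c => (false, here Goal, [:: here (Ctl c)]))) ?orbT //.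
  by rewrite mem_filter rc mem_enum.
move=> l; rewrite !inE => /eqP->.
by have [] := derived_run (p := [::]) value_root_time root_in_cone.
Qed.

End Completeness.

Lemma secret_protocol : remains_secret protocol <-> ~~ goal.
Proof.
split; first by move=> h; apply/negP => g; apply: h => I hI; apply: derived_goal.
by move/negP=> h /known_goal.
Qed.

(** * Validity and single blind copying of the protocol *)

Lemma message_literal l x : level l.1 <= m -> message protocol x ->
  message protocol (literal_term l x).
Proof.
have msg_fn y t : level y <= m -> message protocol t ->
    message protocol (fn (symb_index y) t).
  by move=> le wf; rewrite /message /= has_arity_index //= andbT.
by case: l => y [o|] le wf; apply: (msg_fn) => //; apply: (msg_fn (Child o)).
Qed.

Lemma valid_protocol : valid protocol.
Proof.
have lv c : c \in hclauses -> bounded m c by apply: (allP bounded_hclauses).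
rewrite /valid; apply/and5P; split=> //.
  rewrite all_map; apply/allP => c /lv /andP[lh lb].
  have wx : message protocol (if c.1.1 then Var 0 else dummy) by case: c.1.1.
  apply/and5P; split=> //; last exact: message_literal.
  rewrite [recv _]/=; elim: c.2 lb => //= l ls IH /andP[ll /IH].
  rewrite /message /= => ->.
  by have := message_literal ll wx; rewrite /message /= => ->.
apply/and3P; split=> //; rewrite /message /= has_arity_index //.
Qed.

Lemma single_blind_copying_protocol : single_blind_copying protocol.
Proof.
rewrite /single_blind_copying all_map; apply/allP => c _ /=.
suff sub : {subset undup (rule_vars (rule_of c)) <= [:: 0]}.
  exact: uniq_leq_size (undup_uniq _) sub.
have var0 b : {subset vars (if b then Var 0 else dummy) <= [:: 0]} by case: b.
have lit b l : {subset vars (literal_term l (if b then Var 0 else dummy)) <= [:: 0]}.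
  move=> y; case: l => z [o|]; rewrite /= ?cats0; exact: var0.
move=> y; rewrite mem_undup.
rewrite -[rule_vars _]/(vars (recv (rule_of c)) ++ vars (send (rule_of c))) mem_cat.
case/orP; last exact: (lit c.1.1 c.1.2).
rewrite [recv _]/=; elim: c.2 => [//|l ls IH]; rewrite [foldr _ _ _]/=.
rewrite -[vars _]/(vars (literal_term l _) ++ (vars _ ++ [::])) cats0 mem_cat.
by case/orP=> //; apply: (lit c.1.1 l).
Qed.

End Encoding.

(** * Turing machines as stack machines *)

Section StackSimulation.
Variable T : tm.
Local Notation cell := (sym (tm_aux T)).
Local Notation tapes := 'I_(tm_tapes T).+1.

(* The cell scanned on each tape is kept in the control, together with the
   state; the stacks [(i, false)] and [(i, true)] hold the cells to its left and
   to its right, nearest on top.  The control [None] is left at once, to load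
   the first scanned cells. *)
Definition sim_control : finType := option (tm_state T * {ffun tapes -> cell}).

Definition sim_next (c : sim_control) (g : {ffun tapes * bool -> cell}) :
    sim_control :=
  match c with
  | None => Some (tm_start T, [ffun i => g (i, true)])
  | Some (q, s) =>
      if tm_step q s is Some (q', a) then
        Some (q', [ffun i => match (a i).2 with
          | Left => g (i, false)
          | Stay => (a i).1
          | Right => g (i, true)
          end])
      else c
  end.

Definition sim_act (c : sim_control) (s : tapes * bool) : action cell :=
  match c with
  | None => if s.2 then Pop else Keep
  | Some (q, f) =>
      if tm_step q f is Some (_, a) then
        match (a s.1).2 with
        | Left => if s.2 then Push (a s.1).1 else Pop
        | Stay => Keep
        | Right => if s.2 then Pop else Push (a s.1).1
        end
      else Keep
  end.

Definition simulation : stack_machine := {|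
  control := sim_control;
  stack := (tapes * bool)%type;
  letter := cell;
  start := None;
  input_stack := (ord0, true);
  blank := None;
  letter_of_bit := fun b => Some (inl b);
  next_control := sim_next;
  act := sim_act;
  rejecting := fun c => if c is Some (q, _) then ~~ tm_accept q else true
|}.

(** The stack machine lags by the step that loads the scanned cells. As these are held in the
    control, the right stack starts one cell further, whence [k.+1]. *)
Lemma srun_simulation t w :
  let c := run T t w in let x := srun simulation t.+1 w in
  x.1 = Some (c.1, [ffun i => scanned (c.2 i)]) /\
  forall i k, x.2 (i, false) k = nth None (c.2 i).1 k /\
              x.2 (i, true) k = nth None (c.2 i).2 k.+1.
Proof.
elim: t => [|t [IH1 IH2]] c x.
  rewrite /x /c; split=> [|i k] /=.
    congr (Some (_, _)); apply/ffunP => i; rewrite !ffunE /= xpair_eqE andbT.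
    by rewrite /scanned -nth0; case: ifP.
  by rewrite !xpair_eqE andbF andbT; case: ifP => // _; rewrite ?nth_nil.
rewrite /x /c -[run T t.+1 w]/(step (run T t w)).
rewrite -[srun _ t.+2 w]/(sstep (srun simulation t.+1 w)).
move: (srun simulation t.+1 w) (run T t w) IH1 IH2 => [x1 x2] [q u] /= -> IH2.
rewrite /step /Defs.next /=; set g := [ffun i => _].
case: tm_step => [[q' a]|] //=; split.
  congr (Some (_, _)); apply/ffunP => i; rewrite !ffunE.
  case: (u i) (IH2 i 0) => l r /= [h1 h2]; rewrite /write_move.
  by case: (a i) => s [] /=; rewrite ?ffunE ?h1 ?h2 /scanned -?nth0 //=;
    case: r {h2} => //=.
move=> i k; case: (u i) (IH2 i) => l r /= h; rewrite /write_move.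
case: (a i) => s [] /=; rewrite ?(h _).1 ?(h _).2; split=> //.
all: rewrite ?nth_behead //.
all: by case: k => [|k] //=; rewrite ?(h k).1 ?(h k).2 ?nth_behead.
Qed.

Lemma run_halted t t' w : halted (run T t w) -> t <= t' -> run T t' w = run T t w.
Proof.
move=> h /subnK <-; elim: (t' - t) => // d IH; rewrite addSn.
rewrite -[LHS]/(step (run T (d + t) w)) IH /step.
by move: h; rewrite /halted; case: Defs.next.
Qed.

Lemma secret_simulation L f m w : decides_in_time T L f -> size w <= m ->
  (f (size w)).+2 <= 2 ^ m -> L w <-> remains_secret (protocol simulation m w).
Proof.
move=> /(_ w) [hlt acc] sw le; rewrite secret_protocol // -acc /goal.
(* The root asks for time [2 ^ m - 1]; after the loading step, [2 ^ m - 2] steps of the Turing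
   machine remain, which is at least its time bound. *)
have -> : (2 ^ m).-1 = (2 ^ m - 2).+1 by lia.
have [-> _] := srun_simulation (2 ^ m - 2) w.
by rewrite (run_halted hlt) ?negbK //; lia.
Qed.

End StackSimulation.

(** * Loop programs on tapes *)

Section LoopPrograms.
Variable nt : nat.
Local Notation I := 'I_nt.+1.
Local Notation cell := (sym void).

(* Every tape holds a word, last letter first, with the head just behind its
   last letter.  [Loop i c1 c0] runs [c1] or [c0] for each letter of tape [i],
   from the last to the first, moving the head of tape [i] meanwhile. *)
Inductive cmd :=
| Skip
| Write of I & bool
| Seq of cmd & cmd
| Loop of I & cmd & cmd.

Definition store : Type := {ffun I -> seq bool}.

Definition append (s : store) (i : I) (u : seq bool) : store :=
  [ffun j => if j == i then u ++ s j else s j].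

Fixpoint exec (c : cmd) (s : store) : store :=
  match c with
  | Skip => s
  | Write i b => append s i [:: b]
  | Seq c1 c2 => exec c2 (exec c1 s)
  | Loop i c1 c0 => foldl (fun s b => exec (if b then c1 else c0) s) s (s i)
  end.

(** Besides the body, a letter costs three steps: moving onto it, inspecting it, and crossing it on
    the way back. Three more steps find the blank before the word and leave the loop. *)
Definition loop_cost (cost : bool -> store -> nat) (ex : bool -> store -> store) :=
  fix go (l : seq bool) (s : store) : nat :=
    if l is b :: l' then cost b s + 3 + go l' (ex b s) else 3.

Fixpoint cost (c : cmd) (s : store) : nat :=
  match c with
  | Skip => 1
  | Write i b => 1
  | Seq c1 c2 => cost c1 s + cost c2 (exec c1 s)
  | Loop i c1 c0 =>
      loop_cost (fun b => cost (if b then c1 else c0))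
                (fun b => exec (if b then c1 else c0)) (s i) s
  end.

Fixpoint touched (c : cmd) : seq I :=
  match c with
  | Skip => [::]
  | Write i b => [:: i]
  | Seq c1 c2 => touched c1 ++ touched c2
  | Loop i c1 c0 => i :: touched c1 ++ touched c0
  end.

(** A body may neither write to the tape being looped over nor loop over it, since its head is
    inside the word then. The output tape [ord0] is never looped over, so its length does not enter
    the number of rounds. *)
Fixpoint loop_safe (c : cmd) : bool :=
  match c with
  | Skip | Write _ _ => true
  | Seq c1 c2 => loop_safe c1 && loop_safe c2
  | Loop i c1 c0 =>
      [&& i != ord0, i \notin touched c1 ++ touched c0, loop_safe c1 & loop_safe c0]
  end.

Lemma foldl_inv (T R : Type) (P : R -> Prop) (f : R -> T -> R) z l :
  P z -> (forall x a, P x -> P (f x a)) -> P (foldl f z l).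
Proof. by move=> hz h; elim: l z hz => //= a l IH z hz; apply: IH (h _ _ hz). Qed.

Lemma exec_untouched c (s : store) j : j \notin touched c -> exec c s j = s j.
Proof.
elim: c s => [|i b|c1 IH1 c2 IH2|i c1 IH1 c0 IH0] s //=.
- by rewrite inE ffunE => /negbTE ->.
- by rewrite mem_cat negb_or => /andP[/IH1 h1 /IH2 h2]; rewrite h2 h1.
rewrite inE mem_cat !negb_or => /and3P[_ /IH1 h1 /IH0 h0].
by apply: (foldl_inv (P := fun x : store => x j = s j)) => // x [] <-.
Qed.

Lemma leq_size_exec c (s : store) j : size (s j) <= size (exec c s j).
Proof.
elim: c s => [|i b|c1 IH1 c2 IH2|i c1 IH1 c0 IH0] s //=.
- by rewrite ffunE; case: eqP.
- exact: leq_trans (IH1 _) (IH2 _).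
by apply: (foldl_inv (P := fun x : store => size (s j) <= size (x j))) => // x [] h;
  apply: leq_trans h _.
Qed.

Fixpoint exponent (c : cmd) : nat :=
  match c with
  | Skip | Write _ _ => 1
  | Seq c1 c2 => exponent c1 + exponent c2
  | Loop i c1 c0 => (exponent c1 + exponent c0).+2
  end.

Lemma exponent_gt0 c : 0 < exponent c.
Proof. by elim: c => //= c1 h1 c2 h2; rewrite addn_gt0 h1. Qed.

(** Tapes only grow, so a bound on the final lengths holds throughout and limits every loop to [N]
    rounds. The exponent therefore depends on the program text alone. *)
Lemma cost_leq N c s : loop_safe c ->
  (forall j, j != ord0 -> size (exec c s j) <= N) ->
  cost c s <= N.+3 ^ exponent c.
Proof.
elim: c s => [|i b|c1 IH1 c2 IH2|i c1 IH1 c0 IH0] s //=.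
- case/andP=> w1 w2 hN.
  have h1 := IH1 s w1 (fun j h => leq_trans (leq_size_exec _ _ _) (hN j h)).
  have h2 := IH2 _ w2 hN.
  apply: leq_trans (leq_add h1 h2) _; rewrite expnD.
  have := leq_pexp2l (ltn0Sn N.+2) (exponent_gt0 c1).
  have := leq_pexp2l (ltn0Sn N.+2) (exponent_gt0 c2).
  rewrite !expn1; nia.
case/and4P=> i0 ni w1 w0 hN.
pose f (b : bool) := cost (if b then c1 else c0).
pose g (b : bool) := exec (if b then c1 else c0).
set X := N.+3 ^ (exponent c1 + exponent c0).
have le1 : N.+3 ^ exponent c1 <= X by rewrite leq_pexp2l ?leq_addr.
have le0 : N.+3 ^ exponent c0 <= X by rewrite leq_pexp2l ?leq_addl.
have sz : size (s i) <= N.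
  apply: leq_trans (hN i i0).
  by apply: (foldl_inv (P := fun x : store => size (s i) <= size (x i))) => // x [] h;
    apply: leq_trans h (leq_size_exec _ _ _).
suff : forall (l : seq bool),
    (forall j, j != ord0 -> size (foldl (fun s b => g b s) s l j) <= N) ->
    loop_cost f g l s <= size l * (X + 3) + 3.
  move/(_ _ hN) => h; apply: leq_trans h _.
  have X3 : 3 <= X.
    apply: leq_trans (leq_pexp2l (ltn0Sn N.+2) (_ : 1 <= _)).
      by rewrite expn1.
    by rewrite addn_gt0 exponent_gt0.
  rewrite !expnS -/X; have := leq_mul sz (leqnn (X + 3)); nia.
move=> l; elim: l s {hN sz} => //= b l IH s hN.
have hl := IH _ hN.
have hb j : j != ord0 -> size (g b s j) <= N.
  move=> /hN; apply: leq_trans.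
  by apply: (foldl_inv (P := fun x : store => size (g b s j) <= size (x j))) => //
    x a h;
    apply: leq_trans h (leq_size_exec _ _ _).
have hf : f b s <= X.
  by rewrite /f; case: b hb {hN hl} => h;
    [apply: leq_trans (IH1 _ w1 h) le1|apply: leq_trans (IH0 _ w0 h) le0].
rewrite mulSn; lia.
Qed.

(** * Machine fragments and compilation of programs *)

Record block := Block {
  block_state : finType;
  block_start : block_state;
  block_step : block_state -> {ffun I -> cell} ->
               option block_state * (I -> cell * move)
}.

Definition tapes : Type := I -> tape void.

Definition apply_moves (t : tapes) (a : I -> cell * move) : tapes :=
  fun i => write_move (t i) (a i).

Inductive block_run (B : block) :
  option (block_state B) -> tapes -> nat -> tapes -> Prop :=
| run_exit t : block_run None t 0 t
| run_step q t n t' :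
    let r := block_step q [ffun i => scanned (t i)] in
    block_run r.1 (apply_moves t r.2) n t' -> block_run (Some q) t n.+1 t'.

(** Equality up to trailing blanks, since head movements may list blank cells explicitly. *)
Definition same_tape (t u : tape void) : Prop :=
  nth None t.1 =1 nth None u.1 /\ nth None t.2 =1 nth None u.2.

Lemma same_tape_trans t u v : same_tape t u -> same_tape u v -> same_tape t v.
Proof. by move=> [h1 h2] [h3 h4]; split=> k; rewrite ?h1 ?h2. Qed.

Lemma same_scanned t u : same_tape t u -> scanned t = scanned u.
Proof. by case=> _ /(_ 0); rewrite /scanned -!nth0. Qed.

Lemma same_write_move t u a :
  same_tape t u -> same_tape (write_move t a) (write_move u a).
Proof.
case: t u a => [l r] [l' r'] [s []] /= [/= hl hr]; split=> k //=;
  rewrite ?nth_behead ?hl ?hr //; case: k => [|k] //=;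
  rewrite ?nth_behead ?hl ?hr //.
  by rewrite -!nth0 hl.
by case: k => //= k; rewrite !nth_behead hr.
Qed.

Lemma same_stay t : same_tape (write_move t (scanned t, Stay)) t.
Proof. by case: t => l [|b r]; split=> // -[|[]]. Qed.

Definition letters (u : seq bool) : seq cell := [seq Some (inl b) | b <- u].

Definition word_tape (u : seq bool) : tape void := (letters u, [::]).

Definition move_one (s : {ffun I -> cell}) (i : I) (a : cell * move) :
    I -> cell * move :=
  fun j => if j == i then a else (s j, Stay).

Definition skip_block : block :=
  @Block unit tt (fun _ s => (None, fun j => (s j, Stay))).

Definition write_block (i : I) (b : bool) : block :=
  @Block unit tt (fun _ s => (None, move_one s i (Some (inl b), Right))).

(** The last step of [B1] enters the start state of [B2] directly, so the running times add up
    exactly. *)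
Definition seq_block (B1 B2 : block) : block :=
  @Block (block_state B1 + block_state B2)%type (inl (block_start B1))
    (fun q s => match q with
     | inl q => let r := block_step q s in
        (Some (if r.1 is Some q' then inl q' else inr (block_start B2)), r.2)
     | inr q => let r := block_step q s in (omap inr r.1, r.2)
     end).

(* [None] enters the next cell to the left, [Some true] inspects it, and
   [Some false] goes back to the right end. *)
Definition loop_block (i : I) (B1 B0 : block) : block :=
  @Block (option bool + (block_state B1 + block_state B0))%type (inl None)
    (fun q s => match q with
     | inl None => (Some (inl (Some true)), move_one s i (s i, Left))
     | inl (Some true) =>
        match s i with
        | Some (inl true) =>
            (Some (inr (inl (block_start B1))), fun j => (s j, Stay))
        | Some (inl false) =>
            (Some (inr (inr (block_start B0))), fun j => (s j, Stay))
        | _ => (Some (inl (Some false)), move_one s i (s i, Right))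
        end
     | inl (Some false) =>
        if s i is Some _ then (Some (inl (Some false)), move_one s i (s i, Right))
        else (None, fun j => (s j, Stay))
     | inr (inl q) => let r := block_step q s in
        (Some (if r.1 is Some q' then inr (inl q') else inl None), r.2)
     | inr (inr q) => let r := block_step q s in
        (Some (if r.1 is Some q' then inr (inr q') else inl None), r.2)
     end).

Lemma seq_block_run2 B1 B2 q t n t' : block_run (B := B2) q t n t' ->
  block_run (B := seq_block B1 B2) (omap inr q) t n t'.
Proof.
elim=> {q t n t'} [t|q t n t' r _ IH]; first exact: run_exit.
exact: (@run_step (seq_block B1 B2) (inr q)).
Qed.

Lemma seq_block_run B1 B2 q t n t' n' t'' :
  block_run (B := B1) q t n t' -> block_run (Some (block_start B2)) t' n' t'' ->
  block_run (B := seq_block B1 B2)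
    (Some (if q is Some q1 then inl q1 else inr (block_start B2))) t (n + n') t''.
Proof.
move=> h1 h2; elim: h1 h2 => {q t n t'} [t|q t n t' r _ IH] h2.
  exact: (seq_block_run2 _ h2).
exact: (@run_step (seq_block B1 B2) (inl q)) (IH h2).
Qed.

Lemma loop_block_run1 i B1 B0 q t n t' n' t'' :
  block_run (B := B1) q t n t' ->
  block_run (B := loop_block i B1 B0) (Some (inl None)) t' n' t'' ->
  block_run (B := loop_block i B1 B0)
    (Some (if q is Some q1 then inr (inl q1) else inl None)) t (n + n') t''.
Proof.
move=> h1 h2; elim: h1 h2 => {q t n t'} [t|q t n t' r _ IH] // h2.
exact: (@run_step (loop_block i B1 B0) (inr (inl q))) (IH h2).
Qed.

Lemma loop_block_run0 i B1 B0 q t n t' n' t'' :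
  block_run (B := B0) q t n t' ->
  block_run (B := loop_block i B1 B0) (Some (inl None)) t' n' t'' ->
  block_run (B := loop_block i B1 B0)
    (Some (if q is Some q1 then inr (inr q1) else inl None)) t (n + n') t''.
Proof.
move=> h1 h2; elim: h1 h2 => {q t n t'} [t|q t n t' r _ IH] // h2.
exact: (@run_step (loop_block i B1 B0) (inr (inr q))) (IH h2).
Qed.

Lemma apply_move_one (t : tapes) s i a j : s = [ffun i => scanned (t i)] ->
  same_tape (apply_moves t (move_one s i a) j)
            (if j == i then write_move (t i) a else t j).
Proof.
move=> ->; rewrite /apply_moves /move_one; case: eqP => [->|_] //.
by rewrite ffunE; apply: same_stay.
Qed.

Lemma apply_stay (t : tapes) (s : {ffun I -> cell}) j : s = [ffun i => scanned (t i)] ->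
  same_tape (apply_moves t (fun j => (s j, Stay)) j) (t j).
Proof. by move=> ->; rewrite /apply_moves ffunE; apply: same_stay. Qed.

Lemma same_left t l r : same_tape t (l, r) ->
  same_tape (write_move t (scanned t, Left)) (behead l, head None l :: r).
Proof.
move=> h; apply: same_tape_trans (same_write_move _ h) _.
by rewrite (same_scanned h); case: r {h} => [|a r]; split=> // -[|[|k]] //=;
  rewrite ?nth_nil.
Qed.

Fixpoint compile (c : cmd) : block :=
  match c with
  | Skip => skip_block
  | Write i b => write_block i b
  | Seq c1 c2 => seq_block (compile c1) (compile c2)
  | Loop i c1 c0 => loop_block i (compile c1) (compile c0)
  end.

Lemma loop_back i B1 B0 l r (t : tapes) : same_tape (t i) (letters l, letters r) ->
  exists t', [/\ block_run (B := loop_block i B1 B0) (Some (inl (Some false)))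
                   t (size r).+1 t',
    same_tape (t' i) (word_tape (rev r ++ l)) &
    forall j, j != i -> same_tape (t' j) (t j)].
Proof.
elim: r l t => [|b r IH] l t h; set s := [ffun i => scanned (t i)].
  have si : s i = None by rewrite ffunE (same_scanned h).
  exists (apply_moves t (fun j => (s j, Stay))); split.
  - apply: (@run_step (loop_block i B1 B0)); rewrite /= -/s si /=.
    exact: run_exit.
  - exact: same_tape_trans (apply_stay _ (erefl s)) h.
  - by move=> j _; apply: apply_stay.
have si : s i = Some (inl b) by rewrite ffunE (same_scanned h).
pose t1 := apply_moves t (move_one s i (s i, Right)).
have [|t' [h1 h2 h3]] := IH (b :: l) t1.
  apply: same_tape_trans (apply_move_one i _ i (erefl s)) _; rewrite eqxx si.
  exact: (same_write_move (Some (inl b), Right) h).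
exists t'; split.
- by apply: (@run_step (loop_block i B1 B0)); rewrite /= -/s si /= -si.
- by rewrite rev_cons cat_rcons.
- move=> j ji; apply: same_tape_trans (h3 j ji) _.
  by have := apply_move_one i (s i, Right) j (erefl s); rewrite (negbTE ji).
Qed.

(** Only the touched tapes are required to hold words in the standard form: while a loop body runs,
    the head of the loop tape stands inside its word. *)
Lemma compile_run c (s : store) (t : tapes) : loop_safe c ->
  {in touched c, forall j, same_tape (t j) (word_tape (s j))} ->
  exists n t', [/\ block_run (Some (block_start (compile c))) t n t',
    n <= cost c s,
    {in touched c, forall j, same_tape (t' j) (word_tape (exec c s j))} &
    forall j, j \notin touched c -> same_tape (t' j) (t j)].
Proof.
elim: c s t => [|i b|c1 IH1 c2 IH2|i c1 IH1 c0 IH0] s t /=.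
- move=> _ _; exists 1, (apply_moves t (fun j => ([ffun i => scanned (t i)] j, Stay))).
  split=> //; first by apply: (@run_step skip_block); apply: run_exit.
  by move=> j _; apply: apply_stay.
- move=> _ h; pose s0 := [ffun i => scanned (t i)].
  exists 1, (apply_moves t (move_one s0 i (Some (inl b), Right))).
  split=> //; first by apply: (@run_step (write_block i b)); apply: run_exit.
    move=> j; rewrite inE ffunE => /eqP ->; rewrite eqxx.
    apply: same_tape_trans (apply_move_one _ _ _ erefl) _; rewrite eqxx.
    exact: same_write_move (h _ (mem_head _ _)).
  move=> j; rewrite inE => ji.
  by have := apply_move_one i (Some (inl b), Right) j (erefl s0); rewrite (negbTE ji).
- case/andP=> w1 w2 h.
  have [j hj|n1 [t1 [r1 l1 h1 u1]]] := IH1 s t w1.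
    by apply: h; rewrite mem_cat hj.
  have h1' j : j \in touched c1 ++ touched c2 ->
      same_tape (t1 j) (word_tape (exec c1 s j)).
    case: (boolP (j \in touched c1)) => [/h1 //|nj hj].
    by apply: same_tape_trans (u1 j nj) _; rewrite exec_untouched //; apply: h.
  have [j hj|n2 [t2 [r2 l2 h2 u2]]] := IH2 (exec c1 s) t1 w2.
    by apply: h1'; rewrite mem_cat hj orbT.
  exists (n1 + n2), t2; split; first exact: (seq_block_run r1 r2).
  + exact: leq_add.
  + move=> j hj; case: (boolP (j \in touched c2)) => [/h2 //|nj].
    by apply: same_tape_trans (u2 j nj) _; rewrite [exec c2 _ _]exec_untouched //;
      apply: h1'.
  + move=> j; rewrite mem_cat negb_or => /andP[n1j n2j].
    exact: same_tape_trans (u2 j n2j) (u1 j n1j).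
case/and4P=> _ ni w1 w0 h.
pose f (b : bool) := cost (if b then c1 else c0).
pose g (b : bool) := exec (if b then c1 else c0).
(* The loop in mid-course: [l] is still to be read, and [r], to the right, has been read. The term
   [size r] pays for crossing [r] on the way back. *)
suff main : forall (l r : seq bool) (s : store) (t : tapes),
    same_tape (t i) (letters l, letters r) ->
    {in touched c1 ++ touched c0, forall j, same_tape (t j) (word_tape (s j))} ->
    exists n t', [/\ block_run (B := loop_block i (compile c1) (compile c0))
        (Some (inl None)) t n t',
      n <= loop_cost f g l s + size r,
      same_tape (t' i) (word_tape (rev r ++ l)),
      {in touched c1 ++ touched c0, forall j,
        same_tape (t' j) (word_tape (foldl (fun s b => g b s) s l j))} &
      forall j, j \notin i :: touched c1 ++ touched c0 -> same_tape (t' j) (t j)].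
  have [|j hj|n [t' [h1 h2 h3 h4 h5]]] := main (s i) [::] s t.
  - exact: h (mem_head _ _).
  - by apply: h; rewrite inE hj orbT.
  exists n, t'; split=> //; first by rewrite addn0 in h2.
  move=> j; case: (eqVneq j i) => [-> _|ji]; last by rewrite inE (negbTE ji) => /h4.
  suff -> : foldl (fun s b => g b s) s (s i) i = s i by [].
  move: ni; rewrite mem_cat negb_or => /andP[n1 n0].
  by apply: (foldl_inv (P := fun x : store => x i = s i)) => // x [] <-;
    apply: exec_untouched.
clear s t h; elim=> [|b l IH] r s t hi h1.
  (* All letters have been read: the head meets the blank before the word and returns over [r]. *)
  pose s0 := [ffun i => scanned (t i)].
  pose t1 := apply_moves t (move_one s0 i (s0 i, Left)).
  have ht1 : same_tape (t1 i) ([::], None :: letters r).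
    apply: same_tape_trans (apply_move_one i _ i (erefl s0)) _.
    by rewrite eqxx /s0 ffunE; apply: same_left hi.
  pose s1 := [ffun i => scanned (t1 i)].
  have s1i : s1 i = None by rewrite ffunE (same_scanned ht1).
  pose t2 := apply_moves t1 (move_one s1 i (s1 i, Right)).
  have ht2 : same_tape (t2 i) (letters [::], letters r).
    apply: same_tape_trans (apply_move_one i _ i (erefl s1)) _.
    rewrite eqxx s1i; apply: same_tape_trans (same_write_move _ ht1) _.
    by split=> // -[|k] //=; rewrite ?nth_nil.
  have u2 j : j != i -> same_tape (t2 j) (t j).
    move=> /negbTE ji; apply: (same_tape_trans (u := t1 j)).
      by have := apply_move_one i (s1 i, Right) j (erefl s1); rewrite ji.
    by have := apply_move_one i (s0 i, Left) j (erefl s0); rewrite ji.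
  have [t' [r3 h3 u3]] := loop_back (compile c1) (compile c0) ht2.
  exists (size r).+3, t'; split.
  - apply: (@run_step (loop_block i _ _)); apply: (@run_step (loop_block i _ _)).
    by rewrite /= -/s0 -/t1 -/s1 s1i /= -s1i.
  - by rewrite /= addnC addn3.
  - exact: h3.
  - move=> j hj; have ji : j != i by apply: contraNneq ni => <-.
    exact: same_tape_trans (u3 j ji) (same_tape_trans (u2 j ji) (h1 j hj)).
  - move=> j; rewrite inE negb_or => /andP[ji _].
    exact: same_tape_trans (u3 j ji) (u2 j ji).
(* A letter is left: it is inspected, its branch runs while the head rests on it, and the loop
   resumes with the letter moved to [r]. *)
pose s0 := [ffun i => scanned (t i)].
pose t1 := apply_moves t (move_one s0 i (s0 i, Left)).
have ht1 : same_tape (t1 i) (letters l, letters (b :: r)).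
  apply: same_tape_trans (apply_move_one i _ i (erefl s0)) _.
  by rewrite eqxx /s0 ffunE; apply: same_left hi.
pose s1 := [ffun i => scanned (t1 i)].
have s1i : s1 i = Some (inl b) by rewrite ffunE (same_scanned ht1).
pose t2 := apply_moves t1 (fun j => (s1 j, Stay)).
have u2 j : same_tape (t2 j) (t1 j) by apply: apply_stay.
have u1 j : j != i -> same_tape (t2 j) (t j).
  move=> /negbTE ji; apply: same_tape_trans (u2 j) _.
  by have := apply_move_one i (s0 i, Left) j (erefl s0); rewrite ji.
have nti j : j \in touched c1 ++ touched c0 -> j != i.
  by move=> hj; apply: contraNneq ni => <-.
pose cb := if b then c1 else c0.
have sub : {subset touched cb <= touched c1 ++ touched c0}.
  by rewrite /cb => j; rewrite mem_cat; case: (b) => ->; rewrite ?orbT.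
have h2 j : j \in touched c1 ++ touched c0 -> same_tape (t2 j) (word_tape (s j)).
  by move=> hj; apply: same_tape_trans (u1 _ (nti _ hj)) (h1 _ hj).
have [n1 [t3 [r3 l3 h3 u3]]] : exists n t',
    [/\ block_run (Some (block_start (compile cb))) t2 n t', n <= cost cb s,
     {in touched cb, forall j, same_tape (t' j) (word_tape (exec cb s j))}
     & forall j, j \notin touched cb -> same_tape (t' j) (t2 j)].
  move: sub h2; rewrite /cb; move: (b) => b' sub h2.
  by case: b' sub => sub; [apply: IH1|apply: IH0] => // j hj; apply/h2/sub.
have ni' : i \notin touched cb by apply: contra ni => /sub.
have [||n [t' [r4 l4 h4 h5 u5]]] := IH (b :: r) (g b s) t3.
- exact: same_tape_trans (u3 i ni') (same_tape_trans (u2 i) ht1).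
- move=> j hj; case: (boolP (j \in touched cb)) => [/h3 //|nj].
  by rewrite /g exec_untouched //; apply: same_tape_trans (u3 j nj) (h2 j hj).
exists (n1 + n).+2, t'; split.
- apply: (@run_step (loop_block i _ _)); apply: (@run_step (loop_block i _ _)).
  rewrite /= -/s0 -/t1 -/s1 s1i; move: r3; rewrite /cb; case: (b) => r3.
    exact: (loop_block_run1 r3 r4).
  exact: (loop_block_run0 r3 r4).
- by move: l3 l4; rewrite /= /f /g -/cb; lia.
- by move: h4; rewrite rev_cons cat_rcons.
- exact: h5.
- move=> j hj; apply: same_tape_trans (u5 j hj) _.
  move: hj; rewrite inE negb_or => /andP[ji hj].
  by apply: same_tape_trans (u3 j _) (u1 j ji); apply: contra hj => /sub.
Qed.

(** This bounds the output, whose length is not covered by the hypothesis of [cost_leq], and with it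
    the time for rewinding. *)
Lemma leq_size_cost c (s : store) j : size (exec c s j) <= size (s j) + cost c s.
Proof.
elim: c s => [|i b|c1 IH1 c2 IH2|i c1 IH1 c0 IH0] s /=.
- by rewrite leq_addr.
- by rewrite ffunE; case: eqP => _; rewrite ?addn1 ?leqnSn.
- by have := IH1 s; have := IH2 (exec c1 s); lia.
move: (s i) => l; elim: l s => [|b l IH] s /=; first by rewrite leq_addr.
apply: leq_trans (IH _) _.
suff : size (exec (if b then c1 else c0) s j)
  <= size (s j) + cost (if b then c1 else c0) s by lia.
by case: b.
Qed.

(** * Copying the input, rewinding the output, and polynomial time *)

Variable copies : pred I.
Hypothesis copies0 : ~~ copies ord0.

(** The input is erased while it is copied, so that the output tape starts as an empty word. *)
Definition copy_block : block :=
  @Block unit tt (fun _ s =>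
    if s ord0 is Some (inl b) then
      (Some tt, fun j => if j == ord0 then (None, Right)
         else if copies j then (Some (inl b), Right) else (s j, Stay))
    else (None, fun j => (s j, Stay))).

Lemma copy_run w (s : store) (t : tapes) :
  same_tape (t ord0) ([::], letters w) ->
  (forall j, j != ord0 -> same_tape (t j) (word_tape (s j))) ->
  exists t', [/\ block_run (B := copy_block) (Some tt) t (size w).+1 t',
    same_tape (t' ord0) (word_tape [::]) &
    forall j, j != ord0 ->
      same_tape (t' j) (word_tape (if copies j then rev w ++ s j else s j))].
Proof.
elim: w s t => [|b w IH] s t h0 h; set s0 := [ffun i => scanned (t i)].
  exists (apply_moves t (fun j => (s0 j, Stay))); split.
  - apply: (@run_step copy_block); rewrite /= -/s0.
    have -> : s0 ord0 = None by rewrite ffunE (same_scanned h0).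
    exact: run_exit.
  - exact: same_tape_trans (apply_stay _ (erefl s0)) h0.
  - by move=> j /h; rewrite if_same; apply/same_tape_trans/(apply_stay _ (erefl s0)).
pose a j := if j == ord0 then (None, Right)
  else if copies j then (Some (inl b), Right) else (s0 j, Stay).
pose s' : store := [ffun j => if copies j then b :: s j else s j].
have [||t' [h1 h2 h3]] := IH s' (apply_moves t a).
- apply: same_tape_trans (same_write_move _ h0) _.
  by split=> // -[|k] //=; rewrite nth_nil.
- move=> j j0; rewrite /apply_moves /a (negbTE j0) [s' j]ffunE.
  case: (copies j); first exact: (same_write_move (Some (inl b), Right) (h j j0)).
  exact: same_tape_trans (apply_stay j (erefl s0)) (h j j0).
exists t'; split=> //.
  apply: (@run_step copy_block); rewrite /= -/s0.
  by have -> : s0 ord0 = Some (inl b) by rewrite ffunE (same_scanned h0).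
by move=> j /h3; rewrite ffunE rev_cons cat_rcons; case: copies.
Qed.

(** State [true] moves left and state [false] inspects the cell: two steps for each letter and two
    for the blank before the word. *)
Definition rewind_block : block :=
  @Block bool true (fun q s =>
    if q then (Some false, move_one s ord0 (s ord0, Left))
    else if s ord0 is Some _ then (Some true, fun j => (s j, Stay))
    else (None, move_one s ord0 (s ord0, Right))).

Lemma rewind_run l r (t : tapes) : same_tape (t ord0) (letters l, letters r) ->
  exists2 t', block_run (B := rewind_block) (Some true) t (2 * size l + 2) t' &
    same_tape (t' ord0) ([::], letters (rev l ++ r)).
Proof.
elim: l r t => [|b l IH] r t h.
  pose s0 := [ffun i => scanned (t i)].
  pose t1 := apply_moves t (move_one s0 ord0 (s0 ord0, Left)).
  have ht1 : same_tape (t1 ord0) ([::], None :: letters r).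
    apply: same_tape_trans (apply_move_one ord0 _ ord0 (erefl s0)) _.
    by rewrite /s0 ffunE; apply: same_left h.
  pose s1 := [ffun i => scanned (t1 i)].
  have s1i : s1 ord0 = None by rewrite ffunE (same_scanned ht1).
  exists (apply_moves t1 (move_one s1 ord0 (s1 ord0, Right))).
    apply: (@run_step rewind_block); apply: (@run_step rewind_block).
    by rewrite /= -/s0 -/t1 -/s1 s1i /= -s1i; apply: run_exit.
  apply: same_tape_trans (apply_move_one ord0 _ ord0 (erefl s1)) _.
  rewrite s1i; apply: same_tape_trans (same_write_move _ ht1) _.
  by split=> // -[|k] //=; rewrite ?nth_nil.
pose s0 := [ffun i => scanned (t i)].
pose t1 := apply_moves t (move_one s0 ord0 (s0 ord0, Left)).
have ht1 : same_tape (t1 ord0) (letters l, letters (b :: r)).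
  apply: same_tape_trans (apply_move_one ord0 _ ord0 (erefl s0)) _.
  by rewrite /s0 ffunE; apply: same_left h.
pose s1 := [ffun i => scanned (t1 i)].
have s1i : s1 ord0 = Some (inl b) by rewrite ffunE (same_scanned ht1).
have [t' h1 h2] := IH (b :: r) (apply_moves t1 (fun j => (s1 j, Stay)))
  (same_tape_trans (apply_stay _ (erefl s1)) ht1).
exists t'; last by rewrite rev_cons cat_rcons.
have -> : 2 * size (b :: l) + 2 = (2 * size l + 2).+2 by rewrite /=; lia.
apply: (@run_step rewind_block); apply: (@run_step rewind_block).
by rewrite /= -/s0 -/t1 -/s1 s1i.
Qed.

Definition block_machine (B : block) : tm := {|
  tm_tapes := nt;
  tm_aux := void;
  tm_state := option (block_state B);
  tm_start := Some (block_start B);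
  tm_accept := xpredT;
  tm_step := fun q s =>
    if q is Some q' then let r := block_step q' s in Some (r.1, r.2) else None
|}.

Lemma block_machine_run B q t n t' : block_run (B := B) q t n t' ->
  iter n (@step (block_machine B)) (q, t) = (None, t').
Proof. by elim=> {q t n t'} [t //|q t n t' r _ IH]; rewrite iterSr. Qed.

Lemma leading_bits_letters (u : seq bool) (r : seq cell) :
  nth None r =1 nth None (letters u) -> leading_bits r = u.
Proof.
elim: u r => [|b u IH] [|a r] // h; first by have := h 0; rewrite /= => ->.
  by have := h 0.
have /= -> := h 0; rewrite IH // => k; exact: h k.+1.
Qed.

(** For positive [n], [n + d <= d.+1 * n]; the additive constant covers [n = 0]. The right-hand side
    has the shape required by [polytime]. *)
Lemma poly_bound d K n : (n + d) ^ K <= d.+1 ^ K * n ^ K + d.+1 ^ K.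
Proof.
case: (posnP K) => [->|K0]; first by rewrite !expn0.
case: n => [|n]; first by apply: leq_trans (leq_addl _ _); rewrite leq_exp2r.
apply: leq_trans (leq_addr _ _); rewrite -expnMn leq_exp2r //; nia.
Qed.

Lemma program_polytime (c : cmd) (g : seq bool -> seq bool) d e :
  loop_safe c ->
  (forall w, let s := exec c [ffun j => if copies j then rev w else [::]] in
     s ord0 = rev (g w) /\ forall j, j != ord0 -> size (s j) <= (size w + d) ^ e) ->
  polytime g.
Proof.
move=> safe hc.
pose B := seq_block (seq_block copy_block (compile c)) rewind_block.
(* With [b = size w + (d + 4)], the base in [cost_leq] is at most [b ^ e.+1]; the extra [b ^ 2]
   absorbs copying and rewinding. *)
pose K := e.+1 * exponent c + 2.
exists (block_machine B), ((d + 4).+1 ^ K), K => w.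
set s0 : store := [ffun j => if copies j then rev w else [::]].
have [out sz] := hc w; rewrite -/s0 in out sz.
pose t0 := (init_config (block_machine B) w).2.
pose z : store := [ffun=> [::]].
have [||t1 [r1 h1 h1']] := @copy_run w z t0; first by [].
  by move=> j /negbTE j0; rewrite /t0 /= j0 ffunE.
have [j hj|n [t2 [r2 l2 h2 u2]]] := @compile_run c s0 t1 safe.
  rewrite ffunE; case: (eqVneq j ord0) => [->|/h1']; first by rewrite (negbTE copies0).
  by rewrite ffunE cats0.
have h2' : same_tape (t2 ord0) (letters (rev (g w)), letters [::]).
  rewrite -out; case: (boolP (ord0 \in touched c)) => [/h2 //|n0].
  apply: same_tape_trans (u2 _ n0) _; rewrite exec_untouched // ffunE.
  by rewrite (negbTE copies0).
have [t3 r3 h3] := rewind_run h2'.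
have /block_machine_run := seq_block_run (seq_block_run r1 r2) r3.
rewrite -/B; set total := _ + _ => fin.
have le : total <= (d + 4).+1 ^ K * size w ^ K + (d + 4).+1 ^ K.
  have hc' := cost_leq safe sz.
  have so := leq_size_cost c s0 ord0.
  rewrite ffunE (negbTE copies0) out size_rev /= in so.
  set b := size w + (d + 4).
  have pb : (size w + d) ^ e + 3 <= b ^ e.+1.
    have : 3 ^ e <= b ^ e by case: (posnP e) => [->|e0] //; rewrite leq_exp2r //; lia.
    have : (size w + d) ^ e <= b ^ e.
      by case: (posnP e) => [->|e0] //; rewrite leq_exp2r //; lia.
    have : 0 < 3 ^ e by rewrite expn_gt0.
    have b4 : 4 <= b by rewrite /b; lia.
    rewrite expnS; have := leq_mul b4 (leqnn (b ^ e)); lia.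
  have pc : cost c s0 <= b ^ (e.+1 * exponent c).
    apply: leq_trans hc' _; rewrite expnM leq_exp2r ?exponent_gt0 //.
    by rewrite -addn3.
  apply: leq_trans (poly_bound (d + 4) K (size w)); rewrite -/b /K expnD.
  have : 3 <= b ^ (e.+1 * exponent c).
    apply: leq_trans (leq_pexp2l (m := b) (n1 := 1) _ _).
    - by rewrite expn1 /b; lia.
    - by rewrite /b; lia.
    - by rewrite muln_gt0 exponent_gt0.
  move: pc; rewrite /total size_rev; set X := b ^ _; rewrite /b => *; nia.
have -> : run (block_machine B) ((d + 4).+1 ^ K * size w ^ K + (d + 4).+1 ^ K) w
    = (None, t3).
  rewrite -fin; apply: (run_halted (t := total)) le.
  by rewrite /run (surjective_pairing (init_config _ _)) fin.
split=> //.
by rewrite /output /=; apply: leading_bits_letters => k;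
  rewrite (h3.2 k) revK cats0.
Qed.

End LoopPrograms.

(** * Printing the protocol *)

Section Printing.
Variable nt : nat.
Local Notation I := 'I_nt.+1.

Definition print (u : seq bool) : cmd nt :=
  foldr (fun b => Seq (Write ord0 b)) (Skip _) u.

(** The number of runs of [c] is the product of the tape lengths, by which powers are computed in
    unary. *)
Definition nested (l : seq I) (c : cmd nt) : cmd nt :=
  foldr (fun i c => Loop i c c) c l.

Lemma append_nil (s : store nt) i : append s i [::] = s.
Proof. by apply/ffunP => j; rewrite ffunE if_same. Qed.

Lemma append_append (s : store nt) i u v :
  append (append s i u) i v = append s i (v ++ u).
Proof. by apply/ffunP => j; rewrite !ffunE; case: eqP => //; rewrite catA. Qed.

Lemma appendC (s : store nt) i j u v : i != j ->
  append (append s i u) j v = append (append s j v) i u.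
Proof.
move=> ij; apply/ffunP => k; rewrite !ffunE.
by case: eqP => [->|//]; rewrite eq_sym (negbTE ij).
Qed.

Lemma exec_print u s : exec (print u) s = append s ord0 (rev u).
Proof.
elim: u s => [|b u IH] s; first by rewrite append_nil.
by rewrite /= IH append_append rev_cons -cats1.
Qed.

Lemma exec_loop (i : I) c (s : store nt) :
  exec (Loop i c c) s = iter (size (s i)) (exec c) s.
Proof.
rewrite /=; move: (s i) => l; elim/last_ind: l => //= l b IH.
by rewrite foldl_rcons size_rcons iterS IH if_same.
Qed.

Lemma iter_print u k s :
  iter k (exec (print u)) s = append s ord0 (rev (flatten (nseq k u))).
Proof.
elim: k s => [|k IH] s; first by rewrite append_nil.
by rewrite iterSr exec_print IH append_append -rev_cat.
Qed.

Lemma exec_nested (i : I) l b (s : store nt) : i \notin l ->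
  exec (nested l (Write i b)) s = append s i (nseq (\prod_(j <- l) size (s j)) b).
Proof.
elim: l s => [|j l IH] s; first by rewrite big_nil.
rewrite inE negb_or => /andP[ij il]; rewrite [nested _ _]/= exec_loop big_cons.
elim: (size (s j)) => [|k IHk]; first by rewrite append_nil.
rewrite iterS IHk IH // append_append mulSn nseqD.
congr (append _ _ (nseq _ _ ++ _)); apply: eq_big_seq => a al.
by rewrite ffunE; case: eqP il => // <-; rewrite al.
Qed.

Lemma loop_safe_print u : loop_safe (print u).
Proof. by elim: u. Qed.

Lemma touched_print u : {subset touched (print u) <= [:: ord0]}.
Proof.
by elim: u => //= b u IH j; rewrite !inE => /orP[/eqP->|/IH] //; rewrite inE.
Qed.

Lemma touched_nested l c : {subset touched (nested l c) <= l ++ touched c}.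
Proof.
elim: l => //= i l IH j; rewrite !inE mem_cat.
by case/orP=> [->//|/orP[]/IH ->]; rewrite orbT.
Qed.

Lemma loop_safe_nested l c : uniq (ord0 :: l) -> {in l, forall i, i \notin touched c} ->
  loop_safe c -> loop_safe (nested l c).
Proof.
elim: l => //= i l IH; rewrite inE negb_or => /and3P[/andP[i0 l0] il ul] h sc.
rewrite eq_sym i0 IH ?l0 //; last by move=> j hj; apply: h; rewrite inE hj orbT.
rewrite mem_cat orbb !andbT; apply/negP => /touched_nested; rewrite mem_cat (negbTE il).
by apply/negP/h/mem_head.
Qed.

(* [(true, u)] stands for as many copies of [u] as a counter tape has letters. *)
Definition token : Type := (bool * seq bool)%type.

Definition token_word (n : nat) (k : token) : seq bool :=
  if k.1 then flatten (nseq n k.2) else k.2.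

Definition tokens_word (n : nat) (ks : seq token) : seq bool :=
  flatten (map (token_word n) ks).

Lemma tokens_word_cat n ks ks' :
  tokens_word n (ks ++ ks') = tokens_word n ks ++ tokens_word n ks'.
Proof. by rewrite /tokens_word map_cat flatten_cat. Qed.

Lemma tokens_word_cons n k ks :
  tokens_word n (k :: ks) = token_word n k ++ tokens_word n ks.
Proof. by []. Qed.

Definition print_tokens (i : I) (ks : seq token) : cmd nt :=
  foldr (fun k => Seq (if k.1 then Loop i (print k.2) (print k.2) else print k.2))
        (Skip _) ks.

Lemma exec_print_tokens (i : I) ks s : i != ord0 ->
  exec (print_tokens i ks) s = append s ord0 (rev (tokens_word (size (s i)) ks)).
Proof.
move=> i0; elim: ks s => [|[r u] ks IH] s; first by rewrite append_nil.
rewrite tokens_word_cons rev_cat -append_append.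
have -> : exec (print_tokens i ((r, u) :: ks)) s =
    exec (print_tokens i ks) (append s ord0 (rev (token_word (size (s i)) (r, u)))).
  rewrite [LHS]/=; congr exec; rewrite /token_word; case: r; last exact: exec_print.
  by rewrite exec_loop iter_print.
by rewrite IH ffunE (negbTE i0).
Qed.

Lemma touched_print_tokens i ks :
  {subset touched (print_tokens i ks) <= [:: ord0; i]}.
Proof.
elim: ks => //= [[r u] ks] IH j; rewrite mem_cat => /orP[|/IH //].
have sub k : k \in touched (print u) -> k \in [:: ord0; i].
  by move/touched_print; rewrite !inE => ->.
case: r => [|/sub //]; rewrite inE mem_cat orbb => /orP[/eqP->|/sub //].
by rewrite !inE eqxx orbT.
Qed.

Lemma loop_safe_print_tokens (i : I) ks : i != ord0 -> loop_safe (print_tokens i ks).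
Proof.
move=> i0; elim: ks => //= -[r u] ks ->; rewrite andbT; case: r => /=.
  rewrite i0 loop_safe_print !andbT mem_cat orbb; apply: contra i0 => /touched_print.
  by rewrite inE.
exact: loop_safe_print.
Qed.

End Printing.

(** * Templates of rules with shifted symbols *)

Section Templates.
Variable M : stack_machine.
Local Notation F := #|fixed_symb M|.
Local Notation D := #|indexed_symb M|.

(** In unary, [j] blocks of [D] ones in front of the code of [n] give the code of [n + D * j], the
    number of the symbol shifted by [j]. *)
Definition symbol_tokens (f : symbol) : seq token :=
  if f is Fn n then
    (false, code_nat 3) ::
    rcons (if n < F then [::] else [:: (true, nseq D true)]) (false, code_nat n)
  else [:: (false, code_symbol f)].

Fixpoint term_tokens (t : term) : seq token :=
  match t with
  | Var x => [:: (false, code_term (Var x))]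
  | App f ts =>
      (false, [:: true]) :: symbol_tokens f ++
      foldr (fun u ks => (false, [:: true]) :: term_tokens u ++ ks)
            [:: (false, [:: false])] ts
  end.

Definition shift_symbol (j : nat) (f : symbol) : symbol :=
  if f is Fn n then Fn (shift_index M j n) else f.

Fixpoint shift_term (j : nat) (t : term) : term :=
  match t with
  | Var x => Var x
  | App f ts => App (shift_symbol j f) (map (shift_term j) ts)
  end.

Lemma symbol_tokensE j f :
  tokens_word j (symbol_tokens f) = code_symbol (shift_symbol j f).
Proof.
case: f => //= n; rewrite /tokens_word /= /token_word /= ?cats0 // /shift_index.
case: (_ < _) => /=; rewrite ?cats0; first by [].
do 4 congr (_ :: _).
have -> : flatten (nseq j (nseq D true)) = nseq (D * j) true.
  by elim: j => [|j IH]; rewrite ?muln0 // mulnS nseqD -IH.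
by rewrite addnC /code_nat nseqD rcons_cat.
Qed.

Lemma term_tokensE j t : tokens_word j (term_tokens t) = code_term (shift_term j t).
Proof.
move: t; fix IH 1 => -[x|f ts]; first by rewrite tokens_word_cons cats0.
rewrite [term_tokens _]/= [shift_term _ _]/= [code_term _]/=.
rewrite tokens_word_cons tokens_word_cat symbol_tokensE; congr (_ :: (_ ++ _)).
elim: ts => //= t ts IHs.
by rewrite tokens_word_cons tokens_word_cat IH IHs.
Qed.

Definition rule_tokens (r : rule) : seq token :=
  (false, true :: code_state (source r)) :: term_tokens (recv r) ++
  (false, code_state (target r)) :: term_tokens (send r).

(** List entries without the closing [false], so that the words of successive groups concatenate. *)
Definition clauses_word (cs : seq (hclause M)) : seq bool :=
  flatten [seq true :: code_rule (rule_of c) | c <- cs].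

Definition clauses_tokens (cs : seq (hclause M)) : seq token :=
  flatten [seq rule_tokens (rule_of c) | c <- cs].

Lemma shift_literal_term j (l : literal M) x :
  literal_term (shift_literal j l) (shift_term j x) = shift_term j (literal_term l x).
Proof.
have shift_fn (y : symb M) t : fn (symb_index (shift_symb j y)) (shift_term j t)
    = shift_term j (fn (symb_index y) t) by rewrite index_shift.
by case: l => y [o|]; rewrite /literal_term -!shift_fn.
Qed.

Lemma shift_rule_of j (c : hclause M) : rule_of (shift_hclause j c) =
  Rule (0, [::]) (shift_term j (recv (rule_of c)))
       (1, [::]) (shift_term j (send (rule_of c))).
Proof.
case: c => [[b h] ls]; pose x := if b then Var 0 else dummy.
have shiftE (l : literal M) :
    literal_term (shift_literal j l) x = shift_term j (literal_term l x).
  by rewrite -shift_literal_term; congr literal_term; rewrite /x; case: (b).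
pose tm := foldr (fun (l : literal M) t => pairing (literal_term l x) t) dummy.
have bodyE : tm (map (shift_literal j) ls) = shift_term j (tm ls).
  elim: ls => // l ls IH.
  by rewrite -[LHS]/(pairing (literal_term (shift_literal j l) x)
       (tm (map (shift_literal j) ls))) IH shiftE.
rewrite -[LHS]/(Rule (0, [::]) (tm (map (shift_literal j) ls)) (1, [::])
  (literal_term (shift_literal j h) x)).
by rewrite shiftE bodyE.
Qed.

Lemma clauses_tokensE j cs :
  tokens_word j (clauses_tokens cs) = clauses_word (map (shift_hclause j) cs).
Proof.
elim: cs => // c cs IH.
rewrite -[clauses_tokens _]/(rule_tokens (rule_of c) ++ clauses_tokens cs).
rewrite tokens_word_cat IH; congr (_ ++ _).
by rewrite shift_rule_of tokens_word_cons tokens_word_cat tokens_word_cons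
  !term_tokensE.
Qed.

Lemma clauses_word_cat cs cs' :
  clauses_word (cs ++ cs') = clauses_word cs ++ clauses_word cs'.
Proof. by rewrite /clauses_word map_cat flatten_cat. Qed.

End Templates.

(** * The program that prints the protocol *)

Section Reduction.
Variables (M : stack_machine) (d e : nat).
Hypotheses (d_gt0 : 0 < d) (e_gt0 : 0 < e).
Local Notation I := 'I_(4 + e).+1.
Local Notation F := #|fixed_symb M|.
Local Notation D := #|indexed_symb M|.

Definition word_copy : I := @Ordinal (4 + e).+1 1 isT.
Definition bit_counter : I := @Ordinal (4 + e).+1 2 isT.
Definition letter_counter : I := @Ordinal (4 + e).+1 3 isT.
Definition length_tape : I := @Ordinal (4 + e).+1 4 isT.
Definition factor_tapes : seq I := [seq (rshift 5 j : I) | j <- enum 'I_e].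
Definition input_copies : pred I := fun j => (j == word_copy) || (4 < j).

Definition counter_length (w : seq bool) : nat := (size w + d) ^ e.

Definition print_clauses (i : I) (cs : seq (hclause M)) : cmd (4 + e) :=
  print_tokens i (clauses_tokens cs).

(** The block is the list entry [true :: code_nat 1], the arity of a unary symbol. *)
Definition arity_word (k : nat) : seq bool := flatten (nseq k [:: true; true; false]).

Definition pad : cmd (4 + e) :=
  foldr (fun i c => Seq (iter d (Seq (Write i true)) (Skip _)) c) (Skip _) factor_tapes.

(** The first [false] closes the list of arities; that of [final_word] closes the list of rules. *)
Definition middle_word : seq bool :=
  [:: false] ++ code_seq code_nat [:: 0; 0] ++
  code_seq (code_pair code_nat code_nat) [:: (0, 1)] ++
  code_seq code_state [:: (0, [::])].

Definition final_word : seq bool :=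
  [:: false] ++ code_seq code_nat [::] ++ code_seq code_nat [::] ++
  code_term (fn (symb_index (Goal M)) dummy).

Definition bit_loop : cmd (4 + e) :=
  let c := Seq (print_clauses bit_counter (bit_hclauses M))
               (Write bit_counter true) in
  Loop length_tape c c.

Definition letter_body (b : bool) : cmd (4 + e) :=
  Seq (print_clauses letter_counter (letter_hclauses M b)) (Write letter_counter true).

(** The loops leave their counters at the number of rounds made, the counter length and the length
    of the word, which are the shifts of the groups printed right after them. *)
Definition print_protocol : cmd (4 + e) :=
  Seq (print _ (arity_word (F + D)))
  (Seq (Loop length_tape (print _ (arity_word D)) (print _ (arity_word D)))
  (Seq (print _ (middle_word ++ clauses_word (fixed_hclauses M)))
  (Seq bit_loop
  (Seq (print_clauses bit_counter (zero_hclauses M))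
  (Seq (Loop word_copy (letter_body true) (letter_body false))
  (Seq (print_clauses letter_counter (input_hclauses M))
       (print _ final_word))))))).

Definition reduction : cmd (4 + e) :=
  Seq pad (Seq (nested factor_tapes (Write length_tape true)) print_protocol).

Lemma arity_wordD k k' : arity_word (k + k') = arity_word k ++ arity_word k'.
Proof. by rewrite /arity_word nseqD flatten_cat. Qed.

Lemma arity_wordM k k' : arity_word (k * k') = flatten (nseq k' (arity_word k)).
Proof. by elim: k' => [|k' IH]; rewrite ?muln0 // mulnS arity_wordD IH. Qed.

Lemma code_seqE (A : Type) (code : A -> seq bool) s :
  code_seq code s = flatten [seq true :: code a | a <- s] ++ [:: false].
Proof. by elim: s => //= a s ->; rewrite catA. Qed.

Lemma code_arities k : code_seq code_nat (nseq k 1) = arity_word k ++ [:: false].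
Proof. by rewrite code_seqE map_nseq. Qed.

Lemma code_protocol w : code_instance (protocol M (counter_length w) w) =
  arity_word (F + D) ++ flatten (nseq (counter_length w) (arity_word D)) ++
  middle_word ++ clauses_word (hclauses M (counter_length w) w) ++ final_word.
Proof.
rewrite /code_instance [fn_arity _]/= /fn_count code_arities arity_wordD arity_wordM.
rewrite [code_seq code_rule _]code_seqE -map_comp -/(clauses_word _).
by rewrite /middle_word /final_word -!catA.
Qed.

Lemma print_clausesE (i : I) cs (s : store (4 + e)) : i != ord0 ->
  exec (print_clauses i cs) s
  = append s ord0 (rev (clauses_word (map (shift_hclause (size (s i))) cs))).
Proof. by move=> i0; rewrite exec_print_tokens // clauses_tokensE. Qed.

(** One round of either printing loop: tape [i] counts the rounds in unary and supplies the shift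
    [k] of the current one. *)
Lemma print_count (i : I) cs (s : store (4 + e)) k u : i != ord0 -> s i = [::] ->
  exec (Seq (print_clauses i cs) (Write i true))
       (append (append s i (nseq k true)) ord0 (rev u))
  = append (append s i (nseq k.+1 true)) ord0
      (rev (u ++ clauses_word (map (shift_hclause k) cs))).
Proof.
move=> i0 s0; set s' := append _ ord0 _.
have sz : size (s' i) = k by rewrite !ffunE (negbTE i0) eqxx s0 cats0 size_nseq.
rewrite -[LHS]/(append (exec (print_clauses i cs) s') i [:: true]).
by rewrite print_clausesE // sz /s' append_append -rev_cat -appendC // append_append.
Qed.

Lemma bit_loopE (s : store (4 + e)) : s bit_counter = [::] ->
  exec bit_loop s =
  append (append s bit_counter (nseq (size (s length_tape)) true)) ord0
    (rev (clauses_word (flatten [seq map (shift_hclause i) (bit_hclauses M)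
       | i <- iota 0 (size (s length_tape))]))).
Proof.
move=> s0; rewrite exec_loop; elim: (size _) => [|k IH]; first by rewrite !append_nil.
rewrite iterS IH print_count //; congr (append _ _ (rev _)).
by rewrite -(addn1 k) iotaD map_cat flatten_cat clauses_word_cat /= cats0.
Qed.

Lemma letter_loopE (s : store (4 + e)) w :
  s letter_counter = [::] -> s word_copy = rev w ->
  exec (Loop word_copy (letter_body true) (letter_body false)) s =
  append (append s letter_counter (nseq (size w) true)) ord0
    (rev (clauses_word (word_hclauses M w))).
Proof.
move=> s0; rewrite /= => ->; elim: w => [|b w IH]; first by rewrite !append_nil.
rewrite rev_cons foldl_rcons IH.
have -> : (if b then letter_body true else letter_body false) = letter_body b.
  by case: b.
by rewrite print_count // /= clauses_word_cat.
Qed.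

Lemma padE (s : store (4 + e)) i :
  exec pad s i = if i \in factor_tapes then nseq d true ++ s i else s i.
Proof.
have padd k (j : I) s1 : exec (iter k (Seq (Write j true)) (Skip _)) s1
    = append s1 j (nseq k true).
  elim: k s1 => [|k IH] s1; first by rewrite append_nil.
  by rewrite iterS [LHS]IH append_append -[[:: true]]/(nseq 1 true) -nseqD addn1.
have : uniq factor_tapes.
  by rewrite map_inj_uniq ?enum_uniq // => a b; apply: (@rshift_inj 5).
rewrite /pad; elim: factor_tapes s => //= j l IH s /andP[jl ul].
rewrite padd IH // inE !ffunE; case: eqP => [->|]; last by [].
by rewrite (negbTE jl).
Qed.

Definition initial_store (w : seq bool) : store (4 + e) :=
  [ffun j => if input_copies j then rev w else [::]].

Lemma mem_factor_tapes (i : I) : (i \in factor_tapes) = (4 < i).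
Proof.
apply/mapP/idP => [[j _ ->]|lt]; first by [].
have lt' : i - 5 < e by rewrite ltn_subLR // -[5 + e]/(4 + e).+1.
by exists (Ordinal lt'); rewrite ?mem_enum //; apply: val_inj; rewrite /= subnKC.
Qed.

Definition loaded_store (w : seq bool) : store (4 + e) :=
  append (exec pad (initial_store w)) length_tape (nseq (counter_length w) true).

Lemma loaded_storeE w :
  exec (nested factor_tapes (Write length_tape true)) (exec pad (initial_store w))
  = loaded_store w.
Proof.
rewrite exec_nested ?mem_factor_tapes //; congr (append _ _ (nseq _ _)).
rewrite (eq_big_seq (fun _ => size w + d)) => [|i hi].
  by rewrite big_const_seq count_predT size_map size_enum_ord iter_muln_1.
rewrite padE hi size_cat size_nseq ffunE /input_copies -mem_factor_tapes hi orbT.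
by rewrite size_rev addnC.
Qed.

(** A normal form for the store during printing: [u] has been printed, and [k] and [l] are the two
    counters. Every command becomes a change of these parameters. *)
Definition progress (w u : seq bool) (k l : nat) : store (4 + e) :=
  append (append (append (loaded_store w) bit_counter (nseq k true))
    letter_counter (nseq l true)) ord0 (rev u).

Lemma progress_append w u v k l :
  append (progress w u k l) ord0 (rev v) = progress w (u ++ v) k l.
Proof. by rewrite /progress append_append -rev_cat. Qed.

Lemma loaded_tape w (i : I) : (i < 4) || (i == length_tape) -> loaded_store w i =
  if i == length_tape then nseq (counter_length w) true
  else if i == word_copy then rev w else [::].
Proof.
move=> hi; rewrite ffunE padE mem_factor_tapes ffunE /input_copies.
have -> : 4 < i = false.
  by case/orP: hi => [lt|/eqP->] //; rewrite ltnNge ltnW.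
rewrite orbF; case: (i =P length_tape) => [->|_] //.
by rewrite cats0.
Qed.

Lemma progress_length w u k l : size (progress w u k l length_tape) = counter_length w.
Proof. by rewrite 3!ffunE loaded_tape ?eqxx ?orbT ?size_nseq. Qed.

Lemma progress_word w u k l : progress w u k l word_copy = rev w.
Proof. by rewrite 3!ffunE loaded_tape. Qed.

Lemma progress_bit w u k l : progress w u k l bit_counter = nseq k true.
Proof. by rewrite 3!ffunE loaded_tape //= cats0. Qed.

Lemma progress_letter w u k l : progress w u k l letter_counter = nseq l true.
Proof. by rewrite 3!ffunE loaded_tape //= cats0. Qed.

Lemma progress_output w u k l : progress w u k l ord0 = rev u.
Proof. by rewrite 3!ffunE loaded_tape //= cats0. Qed.

Lemma progress_countb w u k : append (progress w u 0 0) bit_counter (nseq k true)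
  = progress w u k 0.
Proof. by rewrite /progress !append_nil appendC. Qed.

Lemma progress_countl w u k l : append (progress w u k 0) letter_counter (nseq l true)
  = progress w u k l.
Proof. by rewrite /progress append_nil appendC. Qed.

Lemma exec_seq (c1 c2 : cmd (4 + e)) s : exec (Seq c1 c2) s = exec c2 (exec c1 s).
Proof. by []. Qed.

Lemma reductionE w : exec reduction (initial_store w) =
  progress w (code_instance (protocol M (counter_length w) w))
    (counter_length w) (size w).
Proof.
rewrite /reduction 2!exec_seq loaded_storeE.
have -> : loaded_store w = progress w [::] 0 0 by rewrite /progress !append_nil.
rewrite /print_protocol exec_seq exec_print progress_append.
rewrite exec_seq exec_loop iter_print progress_length progress_append.
rewrite exec_seq exec_print progress_append.
rewrite exec_seq bit_loopE ?progress_bit // progress_length progress_countb.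
rewrite progress_append.
rewrite exec_seq print_clausesE // progress_bit size_nseq progress_append.
rewrite exec_seq (letter_loopE (w := w)) ?progress_letter ?progress_word //.
rewrite progress_countl progress_append.
rewrite exec_seq print_clausesE // progress_letter size_nseq progress_append.
rewrite exec_print progress_append code_protocol /hclauses !clauses_word_cat.
by rewrite cat0s -!catA.
Qed.

(** With [d] and [e] positive, the counter length is at least [size w + d], and so bounds the copy
    of the word, the padded factors and both counters. *)
Lemma reduction_size w j : j != ord0 ->
  size (exec reduction (initial_store w) j) <= (size w + d) ^ e.
Proof.
have le : size w + d <= counter_length w.
  by rewrite /counter_length -[leqLHS]expn1 leq_pexp2l // addn_gt0 d_gt0 orbT.
rewrite reductionE -/(counter_length w) => j0.
case: (boolP ((j < 4) || (j == length_tape))) => [|hj].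
  case/orP=> [|/eqP->]; last by rewrite progress_length.
  case: j j0 => [[|[|[|[|j]]]] hj] //= _ _.
  - rewrite (_ : Ordinal hj = word_copy) ?progress_word ?size_rev; last exact: val_inj.
    exact: leq_trans (leq_addr _ _) le.
  - rewrite (_ : Ordinal hj = bit_counter) ?progress_bit ?size_nseq //; exact: val_inj.
  - rewrite (_ : Ordinal hj = letter_counter) ?progress_letter ?size_nseq.
      exact: leq_trans (leq_addr _ _) le.
    exact: val_inj.
have j4 : 4 < j.
  move: hj; rewrite negb_or -leqNgt => /andP[h4 h].
  by rewrite ltn_neqAle h4 andbT; apply: contra h => /eqP e4; apply/eqP/val_inj.
rewrite !ffunE (negbTE j0) padE mem_factor_tapes j4 ffunE /input_copies j4 orbT.
have ne (i : I) : i <= 4 -> (j == i) = false.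
  by move=> i4; apply/eqP => ji; move: j4; rewrite ji ltnNge i4.
by rewrite !ne // size_cat size_nseq size_rev addnC.
Qed.

Lemma reduction_safe : loop_safe reduction.
Proof.
have tp (j : I) u : j != ord0 -> j \notin touched (print _ u).
  by move=> j0; apply: contra j0 => /touched_print; rewrite inE.
have tc (i j : I) cs : j != ord0 -> j != i -> j \notin touched (print_clauses i cs).
  move=> j0 ji; apply/negP => /touched_print_tokens.
  by rewrite !inE (negbTE j0) (negbTE ji).
have sc (i : I) cs : i != ord0 -> loop_safe (print_clauses i cs).
  exact: loop_safe_print_tokens.
have sn : loop_safe (nested factor_tapes (Write length_tape true)).
  apply: loop_safe_nested => //= [|i]; rewrite mem_factor_tapes //.
    rewrite andTb map_inj_uniq ?enum_uniq // => a b; exact: (@rshift_inj 5).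
  by move=> h; rewrite inE; apply: contraL h => /eqP->.
have sp : loop_safe pad.
  rewrite /pad; elim: factor_tapes => //= i l ->; rewrite andbT.
  by elim: (d) => //= k ->.
have sseq c1 c2 : loop_safe c1 -> loop_safe c2 -> loop_safe (Seq c1 c2 : cmd (4 + e)).
  by move=> h1 h2; apply/andP.
have sloop (i : I) c1 c0 : i != ord0 -> i \notin touched c1 -> i \notin touched c0 ->
    loop_safe c1 -> loop_safe c0 -> loop_safe (Loop i c1 c0).
  by move=> i0 h1 h0 s1 s0; apply/and4P; split=> //; rewrite mem_cat negb_or h1.
have tbody (i j : I) cs : j != ord0 -> j != i ->
    j \notin touched (Seq (print_clauses i cs) (Write i true)).
  by move=> j0 ji; rewrite mem_cat negb_or tc // inE.
have sbody (i : I) cs : i != ord0 ->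
    loop_safe (Seq (print_clauses i cs) (Write i true)).
  by move=> i0; apply: (sseq) => //; apply: sc.
have spr u : loop_safe (print (4 + e) u) := loop_safe_print _ u.
apply: (sseq) sp _; apply: (sseq) sn _; apply: (sseq) (spr _) _.
apply: (sseq); first by apply: (sloop) => //; apply: tp.
apply: (sseq) (spr _) _.
apply: (sseq); first by apply: (sloop); rewrite ?tbody ?sbody.
apply: (sseq); first exact: sc.
apply: (sseq); first by apply: (sloop); rewrite ?tbody ?sbody.
by apply: (sseq) (spr _); apply: sc.
Qed.

Lemma protocol_polytime :
  polytime (fun w => code_instance (protocol M (counter_length w) w)).
Proof.
apply: (@program_polytime (4 + e) input_copies isT reduction _ d e reduction_safe).
move=> w s; split=> [|j]; last exact: reduction_size.
by rewrite /s reductionE progress_output.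
Qed.

End Reduction.

(** * Reduction from an arbitrary language in DEXPTIME *)

Lemma dexptime_reduction L : dexptime L ->
  exists2 P : seq bool -> instance, polytime (fun w => code_instance (P w)) &
    forall w, [/\ valid (P w), single_blind_copying (P w), no_stored_message (P w)
                & L w <-> remains_secret (P w)].
Proof.
case=> T [c [k dec]].
(* With [n = size w], the counter length [(n + c + 2) ^ (k + 2)] exceeds [c * n ^ k + c] by at least
   two, so [2 ^ m] is at least four times the running time. *)
exists (fun w => protocol (simulation T) (counter_length c.+2 k.+2 w) w).
  exact: protocol_polytime.
move=> w; set m := counter_length _ _ _.
have sz : size w <= m.
  rewrite /m /counter_length expnS; apply: leq_trans (leq_addr c.+2 _) _.
  by rewrite leq_pmulr // expn_gt0 addnS.
split; [exact: valid_protocol|exact: single_blind_copying_protocol|by []|].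
apply: secret_simulation (dec) _ _ => //.
have le : (c * size w ^ k + c).+2 <= m.
  rewrite /m /counter_length 2!expnS mulnA.
  have h1 : size w ^ k <= (size w + c.+2) ^ k.
    by case: (posnP k) => [->|k0] //; rewrite leq_exp2r // leq_addr.
  have h2 : 0 < (size w + c.+2) ^ k by rewrite expn_gt0 addnS.
  by nia.
apply: leq_trans (_ : 2 ^ (c * size w ^ k + c).+2 <= _); last by rewrite leq_exp2l.
rewrite !expnS; have := expn_gt0 2 (c * size w ^ k + c); rewrite /=; lia.
Qed.

(** The same reduction serves both classes. Conversely, a word in the language comes from some
    secret-keeping instance, which is the printed one by injectivity of the encoding. *)
Theorem theorem1 :
  dexptime_hard (secrecy_problem single_blind_copying) /\
  dexptime_hard (secrecy_problem
    (fun P : instance => single_blind_copying P && no_stored_message P)).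
Proof.
split=> L /dexptime_reduction[P poly hP]; exists (fun w => code_instance (P w)) => // w;
  have [v sbc ns ->] := hP w; split.
- by move=> s; exists (P w).
- by case=> Q [_ _ s /code_instance_inj ->].
- by move=> s; exists (P w); rewrite sbc.
- by case=> Q [_ _ s /code_instance_inj ->].
Qed.
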